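(* Let $G$ be a connected claw-free graph. If $\sigma^{4}_{4}(G)\geqslant |G|-7$ or $\sigma^{5}_{2}(G)\geqslant |G|-9$, then $G$ has a spanning tree $T$ such that $\mathrm{Stem}(T)$ is a spider.
   Context: All graphs are finite and simple (no loops, no multiple edges). $|G|$ denotes the number of vertices of $G$, $\deg_G(v)$ the degree of $v$ in $G$, and $d_G(u,v)$ the distance between $u$ and $v$ in $G$. A graph is claw-free if it has no induced subgraph isomorphic to $K_{1,3}$. For an integer $l\geqslant 2$, $\alpha^{l}(G)=\max\{|S| : S\subset V(G),\ d_G(x,y)\geqslant l \text{ for all distinct } x,y\in S\}$. For integers $l\geqslant 2$ and $m\geqslant 2$, $$\sigma^{l}_{m}(G)=\min\Big\{\sum_{a\in S}\deg_G(a) : S\subset V(G),\ |S|=m,\ d_G(x,y)\geqslant l \text{ for all distinct } x,y\in S\Big\},$$ with the convention $\sigma^{l}_{m}(G)=+\infty$ if $\alpha^{l}(G)<m$. For a tree $T$, a leaf is a vertex of degree one in $T$, and $\mathrm{Leaf}(T)$ is the set of leaves of $T$. A branch vertex of a tree is a vertex of degree at least three in that tree. A spider is a tree having at most one branch vertex. The stem of $T$ is the subtree $\mathrm{Stem}(T)=T-\mathrm{Leaf}(T)$ obtained by deleting all leaves of $T$ (branch vertices of $\mathrm{Stem}(T)$ are those of degree at least three in $\mathrm{Stem}(T)$). In the degenerate case $T=K_2$, the stem is empty and is regarded as a (trivial) spider, having no branch vertices. *)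

(* Defs.v *)
From mathcomp Require Import all_boot all_order all_algebra.
From mathcomp Require Import constructive_ereal.

Set Implicit Arguments.
Unset Strict Implicit.
Unset Printing Implicit Defensive.

Import Order.TTheory GRing.Theory Num.Theory.

(* A finite simple graph is a symmetric irreflexive relation [e : rel V] on a
   finType.  Distances and degree sums live in [\bar int], so that [+oo] and
   differences such as [|G| - 7] have their usual (untruncated) meaning. *)

Definition deg (V : finType) (e : rel V) (x : V) : nat :=
  #|[set y | e x y]|.

(* The null graph is not connected. *)
Definition connected_graph (V : finType) (e : rel V) : Prop :=
  0 < #|V| /\ forall x y : V, connect e x y.

(* K_{1,3}, with centre [None]. *)
Definition K13 : rel (option 'I_3) := fun x y => isSome x != isSome y.

Definition claw_free (V : finType) (e : rel V) : Prop :=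
  ~ exists f : option 'I_3 -> V,
      injective f /\ forall i j, e (f i) (f j) = K13 i j.

Definition has_walk (V : finType) (e : rel V) (n : nat) (x y : V) : bool :=
  [exists p : n.-tuple V, path e x p && (last x p == y)].

(* A shortest walk has no repeated vertex, hence fewer than [#|V|] edges; the
   distance is [+oo] when no walk exists. *)
Definition dist (V : finType) (e : rel V) (x y : V) : \bar int :=
  \big[Order.min/+oo%E]_(n < #|V| | has_walk e n x y) (n%:Z)%:E.

Definition far_apart (V : finType) (e : rel V) (l : nat) (S : {set V}) : bool :=
  [forall x in S, forall y in S, (x != y) ==> ((l%:Z)%:E <= dist e x y)%E].

(* The minimum over no set is [+oo]; this is the case alpha^l < m, because
   [far_apart] is inherited by subsets. *)
Definition sigma (V : finType) (e : rel V) (l m : nat) : \bar int :=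
  \big[Order.min/+oo%E]_(S : {set V} | (#|S| == m) && far_apart e l S)
     ((\sum_(a in S) deg e a)%N%:Z)%:E.

Definition acyclic (V : finType) (t : rel V) : Prop :=
  forall c : seq V, 2 < size c -> ~ ucycle t c.

Definition is_tree (V : finType) (t : rel V) : Prop :=
  [/\ symmetric t, irreflexive t, connected_graph t & acyclic t].

Definition spanning_tree (V : finType) (e t : rel V) : Prop :=
  subrel t e /\ is_tree t.

Definition is_spider (V : finType) (t : rel V) : Prop :=
  is_tree t /\ #|[set x | 3 <= deg t x]| <= 1.

Definition is_leaf (V : finType) (t : rel V) (x : V) : bool := deg t x == 1.

Definition stem_vertex (V : finType) (t : rel V) : finType :=
  {x : V | ~~ is_leaf t x}.

Definition stem (V : finType) (t : rel V) : rel (stem_vertex t) :=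
  fun x y => t (val x) (val y).

(* The first alternative is the empty stem, which for a tree [t] only occurs
   when [t] is K_2 and which is conventionally a spider. *)
Definition stem_is_spider (V : finType) (t : rel V) : Prop :=
  #|stem_vertex t| = 0 \/ is_spider (@stem V t).

(* Main.v *)
Require Import Defs.
From mathcomp Require Import all_boot all_order all_algebra.
From mathcomp Require Import constructive_ereal zify.
From Stdlib Require Import Classical.

(** The stem of a spanning tree built from a connected dominating subgraph F by
    hanging every other vertex on it lies inside F.  So it is enough to find a
    dominating spider: a connected subgraph F of G, on a dominating vertex set
    S, with at most one vertex of degree above two.

    Suppose there is none.  Measure a subgraph by its excess, the sum of the
    numbers deg(v) - 2 over the vertices of degree above two; for a tree this is
    the number of leaves minus two.  Among the connected dominating subgraphs
    take one of least excess and, among these, one with fewest edges.  It is a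
    tree, each leaf x has a private neighbour y outside S, and since it has two
    branch vertices there are four leaves, two on either side of a branch vertex
    b ([four_leaves]).

    Least excess forbids joining two leaves x, x' by a walk outside S: closing
    the cycle and cutting it next to a branch vertex would lower the excess
    ([leaf_nonadj], [reach_nonadj]).  Hence private neighbours of distinct leaves
    are at distance at least 4.  If the distance is exactly 4, the middle vertex
    c of a shortest walk lies on S and is joined to x and to x' outside S.  As G
    has no claw, every F-neighbour of c is adjacent to the last vertex of one of
    these two connections, and the exchange of an edge at c shows that c is a cut
    vertex of F with x and x' in its two sides ([cut_vertex]).  A second exchange
    shows that the cut vertices of two pairs with a common leaf do not both keep
    the two other leaves on one side ([links_not_parallel]).  If all six pairs of the
    four leaves were at distance 4, their six cut vertices would lie on the five
    segments of the subtree spanned by the four leaves, where there is no room for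
    all of them ([not_all_linked]).  So some two of the four private neighbours are at
    distance at least 5.

    Thus either degree sum condition applies to the private neighbours.  Their
    closed neighbourhoods are disjoint and contain no vertex of S other than the
    four leaves, so both conditions leave at most three further vertices in S
    ([few_inner_vertices]).  The claws that are excluded at these three vertices
    force a spider through all of S ([few_inner_spider]), a contradiction. *)

Set Implicit Arguments.
Unset Strict Implicit.
Unset Printing Implicit Defensive.

Lemma exists_minimal (T : Type) (P : T -> Prop) (f : T -> nat) :
  (exists x, P x) -> exists x, P x /\ forall y, P y -> f x <= f y.
Proof.
case=> x; have [n le_n] := ubnP (f x).
elim: n x le_n => // n IHn x le_n Px.
have [[y [Py lt_yx]]|no_less] := classic (exists y, P y /\ f y < f x).
  by apply: (IHn y) => //; lia.
exists x; split=> // y Py; rewrite leqNgt; apply/negP => lt_yx.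
by apply: no_less; exists y.
Qed.

(** * Connectivity and degrees after editing a relation *)

Section Edits.
Variable V : finType.
Implicit Types (F : rel V) (x y z c d : V).

(** Deleting a vertex keeps the carrier and isolates the vertex, so that
    connectivity in the graph without c is [connect (delV F c)]. *)
Definition delV F c : rel V := [rel x y | [&& F x y, x != c & y != c]].

Definition delE F a b : rel V :=
  [rel x y | [&& F x y, (x, y) != (a, b) & (x, y) != (b, a)]].

Definition addE F a b : rel V :=
  [rel x y | [|| F x y, (x, y) == (a, b) | (x, y) == (b, a)]].

Lemma delV_sym F c : symmetric F -> symmetric (delV F c).
Proof. by move=> sF x y; rewrite /delV /= sF; case: (F y x); rewrite //= andbC. Qed.

Lemma delE_sym F a b : symmetric F -> symmetric (delE F a b).
Proof.
move=> sF x y; rewrite /delE /addE /= sF !xpair_eqE; case: (F y x) => //=.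
by rewrite andbC; congr (~~ _ && ~~ _); rewrite andbC.
Qed.

Lemma addE_sym F a b : symmetric F -> symmetric (addE F a b).
Proof.
move=> sF x y; rewrite /delE /addE /= sF !xpair_eqE; case: (F y x) => //=.
by rewrite orbC; congr (_ || _); rewrite andbC.
Qed.

Lemma sub_delV F c : subrel (delV F c) F.
Proof. by move=> x y /and3P[]. Qed.

Lemma sub_delE F a b : subrel (delE F a b) F.
Proof. by move=> x y /and3P[]. Qed.

Lemma sub_addE F a b : subrel F (addE F a b).
Proof. by move=> x y Fxy; apply/orP; left. Qed.

Lemma delV_subrel F F' c : subrel F F' -> subrel (delV F c) (delV F' c).
Proof. by move=> sub x y /and3P[/sub Fxy xc yc]; apply/and3P. Qed.

Lemma delV_delE F a b : subrel (delV F a) (delE F a b).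
Proof.
move=> x y /and3P[Fxy xa ya]; apply/and3P; split=> //; rewrite xpair_eqE.
  by rewrite (negPf xa).
by rewrite (negPf ya) andbF.
Qed.

Lemma delV_delEr F a b : subrel (delV F b) (delE F a b).
Proof.
by move=> x y /(@delV_delE F b a)/and3P[Fxy ? ?]; apply/and3P.
Qed.

Lemma connect_subrel F F' x y : subrel F F' -> connect F x y -> connect F' x y.
Proof. by move=> sub; apply: connect_sub => {}x {}y /sub /connect1. Qed.

Lemma connect_indr F x (P : V -> Prop) :
  P x -> (forall y z, connect F x y -> P y -> F y z -> P z) ->
  forall y, connect F x y -> P y.
Proof.
move=> Px IH y /connectP[p + ->]; elim/last_ind: p => [|p z IHp] //=.
rewrite rcons_path last_rcons => /andP[pF Fz].
by apply: IH (IHp pF) Fz; apply/connectP; exists p.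
Qed.

Lemma connect_indl F y (P : V -> Prop) :
  P y -> (forall x z, F x z -> connect F z y -> P z -> P x) ->
  forall x, connect F x y -> P x.
Proof.
move=> Py IH x /connectP[p]; elim: p x => [|z p IHp] x /=; first by move=> _ <-.
case/andP=> Fxz pF def_y; apply: IH Fxz _ (IHp _ pF def_y).
by apply/connectP; exists p.
Qed.

Lemma connect_delVN F c x : connect (delV F c) x c -> x = c.
Proof.
by elim/connect_indl => // y z /and3P[_ yc zc] _ ze; rewrite ze eqxx in zc.
Qed.

(** The vertex s precedes the first visit to c. *)
Lemma connect_enter F v c : connect F v c -> v != c ->
  exists s, F s c /\ connect (delV F c) v s.
Proof.
elim/connect_indl => [|x z Fxz _ IH xc]; first by rewrite eqxx.
have [zc|zc] := eqVneq z c; first by exists x; rewrite -{1}zc connect0.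
have [s [Fsc zs]] := IH zc; exists s; split=> //.
by apply: connect_trans zs; apply: connect1; apply/and3P.
Qed.

Lemma connect_first F c d x : c != d -> connect F x c ->
  connect (delV F d) x c \/ connect (delV F c) x d.
Proof.
move=> cd; elim/connect_indl => [|{}x z Fxz _ IH]; first by left.
have [-> |xc] := eqVneq x c; first by left.
have [-> |xd] := eqVneq x d; first by right.
have [zd|zd] := eqVneq z d.
  by right; rewrite -zd; apply/connect1/and3P; split=> //; rewrite zd eq_sym.
have [zc|zc] := eqVneq z c.
  by left; rewrite -zc; apply/connect1/and3P; split=> //; rewrite zc.
case: IH => IH; [left|right]; apply: connect_trans IH; apply: connect1;
by apply/and3P.
Qed.

Lemma connect_avoid F d x y :
  connect F x y -> ~~ connect F x d -> connect (delV F d) x y.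
Proof.
move=> xy xNd; elim/connect_indr: xy => // {}y z xy xy' Fyz.
apply: connect_trans xy' (connect1 _); apply/and3P; split=> //.
  by apply: contraNneq xNd => <-.
by apply: contraNneq xNd => <-; apply: connect_trans xy (connect1 _).
Qed.

Lemma connect_delE_dicho F u v x :
  connect F x u -> connect (delE F u v) x u \/ connect (delE F u v) x v.
Proof.
elim/connect_indl => [|{}x z Fxz _ IH]; first by left.
have [xu|xu] := eqVneq x u; first by left; rewrite xu.
have [xv|xv] := eqVneq x v; first by right; rewrite xv.
have edge: connect (delE F u v) x z.
  by apply/connect1/and3P; split=> //; rewrite xpair_eqE ?(negPf xu) ?(negPf xv).
by case: IH; [left|right]; apply: connect_trans edge _.
Qed.

Lemma path_delV F c x p : path F x p -> c \notin x :: p -> path (delV F c) x p.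
Proof.
elim: p x => //= y p IHp x /andP[Fxy pF].
rewrite inE negb_or => /andP[cx cyp]; rewrite IHp // /delV /= Fxy eq_sym cx.
by move: cyp; rewrite inE negb_or eq_sym => /andP[-> _].
Qed.

Lemma deg_gt0 F x y : F x y -> 0 < deg F x.
Proof. by move=> Fxy; apply/card_gt0P; exists y; rewrite inE. Qed.

Lemma deg_le1 F x y z : deg F x <= 1 -> F x y -> F x z -> y = z.
Proof. by move=> /card_le1_eqP dx Fy Fz; apply: dx; rewrite inE. Qed.

Lemma deg_le2 F x y z w :
  deg F x <= 2 -> F x y -> F x z -> y != z -> F x w -> w = y \/ w = z.
Proof.
move=> dx Fy Fz yz Fw; have [|wy] := eqVneq w y; first by left.
have [|wz] := eqVneq w z; first by right.
suff: 2 < deg F x by rewrite ltnNge dx.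
have: #|[set w; y; z]| <= deg F x.
  by apply/subset_leq_card/subsetP=> t; rewrite !inE -orbA => /or3P[]/eqP->.
by rewrite setUC cardsU1 cards2 !inE negb_or wy ![z == _]eq_sym yz wz.
Qed.

Lemma deg_ge2 F x t : 1 < deg F x -> exists y, F x y /\ y != t.
Proof.
rewrite /deg (cardsD1 t) => d2; have b1 := leq_b1 (t \in [set y | F x y]).
have/card_gt0P[y]: 0 < #|[set y | F x y] :\ t| by lia.
by rewrite !inE => /andP[yt Fy]; exists y.
Qed.

Lemma deg_ge3 F x t : 2 < deg F x ->
  exists y z, [/\ F x y, F x z, y != t, z != t & y != z].
Proof.
move=> d3; have [|y [Fy yt]] := @deg_ge2 F x t; first by lia.
move: d3; rewrite /deg (cardsD1 t) (cardsD1 y) => d3.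
have b1 := leq_b1 (t \in [set y | F x y]).
have b2 := leq_b1 (y \in [set y | F x y] :\ t).
have/card_gt0P[z]: 0 < #|[set y | F x y] :\ t :\ y| by lia.
by rewrite !inE => /and3P[zy zt Fz]; exists y, z; split; rewrite // eq_sym.
Qed.

Lemma deg_subrel F F' x : subrel F F' -> deg F x <= deg F' x.
Proof. by move=> sub; apply/subset_leq_card/subsetP=> y; rewrite !inE => /sub. Qed.

Lemma deg_addE F a b x : a != b ->
  deg (addE F a b) x <= deg F x + (x == a) + (x == b).
Proof.
move=> ab.
have sub y : addE F a b x y ->
    y \in [set y | F x y] :|: [set y | (x == a) && (y == b)]
          :|: [set y | (x == b) && (y == a)].
  by rewrite /addE /= !inE !xpair_eqE orbA.
apply: (@leq_trans #|[set y | F x y] :|: [set y | (x == a) && (y == b)]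
          :|: [set y | (x == b) && (y == a)]|).
  by apply/subset_leq_card/subsetP=> y; rewrite [in X in X -> _]inE => /sub.
have card1 (P : bool) (t : V) : #|[set y | P && (y == t)]| <= P.
  case: P => /=; last by rewrite leqn0 cards_eq0; apply/eqP/setP=> y; rewrite !inE.
  by rewrite -(cards1 t); apply/subset_leq_card/subsetP=> y; rewrite !inE.
have := card1 (x == a) b; have := card1 (x == b) a.
have := cardsU ([set y | F x y] :|: [set y | (x == a) && (y == b)])
               [set y | (x == b) && (y == a)].
have := cardsU [set y | F x y] [set y | (x == a) && (y == b)].
rewrite /deg; lia.
Qed.

Lemma deg_delE_lt F a b : F a b -> deg (delE F a b) a < deg F a.
Proof.
move=> Fab; apply/proper_card/properP; split.
  by apply/subsetP=> y; rewrite !inE => /and3P[].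
by exists b; rewrite inE ?Fab // /delE /= eqxx andbF.
Qed.

Lemma deg_delE_ltr F a b : symmetric F -> F a b -> deg (delE F a b) b < deg F b.
Proof.
move=> sF; rewrite sF => /deg_delE_lt; apply: leq_ltn_trans.
by apply: deg_subrel => x y /and3P[Fxy ? ?]; apply/and3P.
Qed.

(** Sending x to its only neighbour retracts the graph onto the graph
    without x, so a vertex of degree one is never needed as an inner vertex. *)
Lemma connect_delV_leaf F x u v : symmetric F -> deg F x <= 1 ->
  connect F u v -> u != x -> v != x -> connect (delV F x) u v.
Proof.
move=> sF dx uv ux vx.
(* The invariant is transported along the retraction: at x itself it speaks of
   the neighbours of x. *)
pose P w := if w != x then connect (delV F x) w v : Prop
            else forall t, F x t -> t != x -> connect (delV F x) t v.
suff: P u by rewrite /P ux.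
elim/connect_indl: uv {ux} => [|{}u z Fuz _]; rewrite /P ?vx //.
case: (eqVneq z x) Fuz => [->|zx] Fuz; case: (eqVneq u x) Fuz => [->|ux] Fuz //= Pz.
- by apply: Pz => //; rewrite sF.
- by move=> t Fxt _; rewrite (deg_le1 dx Fxt Fuz).
- by apply: connect_trans Pz; apply/connect1/and3P.
Qed.

(** Along a path all of whose vertices have degree at most two every edge is
    already used up by the path, so walks cannot leave it. *)
Lemma path_closed F x p : symmetric F -> path F x p -> uniq (x :: p) ->
  (forall v, v \in p -> deg F v <= 2) -> deg F (last x p) <= 1 ->
  forall v w, v \in p -> F v w -> w \in x :: p.
Proof.
move=> sF; elim: p x => // y p IHp x /=.
move=> /andP[Fxy pF] /andP[xp up] d2 d1 v w; rewrite [v \in _]inE.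
case/orP=> [/eqP->|vp] Fvw.
  case: p pF {IHp up} xp d2 d1 => [|z p] /= pF xp d2 d1.
    have Fyx : F y x by rewrite sF.
    by rewrite (deg_le1 d1 Fvw Fyx) inE eqxx.
  case/andP: pF => Fyz _.
  have Fyx : F y x by rewrite sF.
  have xz : x != z by apply: contraNneq xp => ->; rewrite !inE eqxx orbT.
  have dy : deg F y <= 2 by apply: d2; rewrite inE eqxx.
  by case: (deg_le2 dy Fyx Fyz xz Fvw) => ->; rewrite !inE eqxx ?orbT.
rewrite inE (IHp y _ _ _ _ v w) ?orbT // => u up'; apply: d2.
by rewrite inE up' orbT.
Qed.

Definition branches F := [set x | 2 < deg F x].

(** For a tree this is the number of leaves minus two.  Unlike the number of
    leaves, it can only go down when edges are deleted, so intermediate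
    subgraphs need not be trees. *)
Definition excess F := \sum_x (deg F x - 2).

Lemma excess_le F F' :
  (forall x, deg F' x <= maxn 2 (deg F x)) -> excess F' <= excess F.
Proof. by move=> le; apply: leq_sum => x _; have := le x; lia. Qed.

Lemma excess_lt F F' u :
  (forall x, deg F' x <= maxn 2 (deg F x)) -> 2 < deg F u ->
  deg F' u < deg F u -> excess F' < excess F.
Proof.
move=> le u3 lt_u; rewrite /excess (bigD1 u) //= [X in _ < X](bigD1 u) //=.
have: \sum_(x | x != u) (deg F' x - 2) <= \sum_(x | x != u) (deg F x - 2).
  by apply: leq_sum => x _; have := le x; lia.
lia.
Qed.

Lemma excess_gt0 F : 0 < excess F -> exists u, 2 < deg F u.
Proof.
rewrite lt0n sum_nat_eq0 negb_forall => /existsP[u].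
by rewrite /= => du; exists u; lia.
Qed.

(** Twice the number of edges. *)
Definition darts F := \sum_x deg F x.

Lemma darts_lt F F' x : subrel F F' -> deg F x < deg F' x -> darts F < darts F'.
Proof.
move=> sub lt; rewrite /darts (bigD1 x) //= [X in _ < X](bigD1 x) //=.
by rewrite -addSn leq_add // leq_sum // => y _; apply: deg_subrel.
Qed.

(** A connected graph with this property is a tree. *)
Definition bridges F := forall u v, F u v -> ~~ connect (delE F u v) u v.

End Edits.

(** * Connected subgraphs *)

Section Subgraphs.
Variables (V : finType) (e : rel V).
Hypotheses (e_sym : symmetric e) (e_irr : irreflexive e).
Implicit Types (F : rel V) (S : {set V}) (x y z c d : V).

(** A connected subgraph, not necessarily induced; keeping S apart from F allows a
    single vertex. *)
Record subgraph S F : Prop := Subgraph {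
  sg_sym : symmetric F;
  sg_sub : subrel F e;
  sg_in : forall x y, F x y -> x \in S;
  sg_conn : forall x y, x \in S -> y \in S -> connect F x y }.

Definition dominating S := forall v, v \in S \/ exists2 u, u \in S & e u v.

(** In a connected subgraph with at least two vertices this means degree
    exactly one; the upper bound is what exchanges preserve. *)
Record leaf S F x : Prop := Leaf { leaf_in : x \in S; leaf_deg : deg F x <= 1 }.

Lemma sg_inr S F x y : subgraph S F -> F x y -> y \in S.
Proof. by move=> sg; rewrite (sg_sym sg) => /(sg_in sg). Qed.

Lemma sg_neq S F x y : subgraph S F -> F x y -> x != y.
Proof.
by move=> sg /(sg_sub sg); apply: contraTneq => ->; rewrite e_irr.
Qed.

Lemma sg_Vsym S F c : subgraph S F -> connect_sym (delV F c).
Proof. by move=> sg; apply/sym_connect_sym/delV_sym/(sg_sym sg). Qed.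

Lemma sg_Esym S F a b : subgraph S F -> connect_sym (delE F a b).
Proof. by move=> sg; apply/sym_connect_sym/delE_sym/(sg_sym sg). Qed.

Lemma deg_out S F x : subgraph S F -> x \notin S -> deg F x = 0.
Proof.
move=> sg xS; apply/eqP; rewrite cards_eq0; apply/eqP/setP=> y; rewrite !inE.
by apply: contraNF xS => /(sg_in sg).
Qed.

Lemma subgraph_pendant S F x z : subgraph S F -> x \in S -> z \notin S -> e x z ->
  subgraph (z |: S) (addE F x z).
Proof.
move=> sg xS zS exz; split.
- exact/addE_sym/(sg_sym sg).
- move=> u v /or3P[/(sg_sub sg)//| |] /eqP[-> ->] //; by rewrite e_sym.
- move=> u v /or3P[/(sg_in sg)| |]; first by rewrite !inE => ->; rewrite orbT.
    by case/eqP=> -> _; rewrite !inE xS orbT.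
  by case/eqP=> -> _; rewrite !inE eqxx.
have sF' := addE_sym x z (sg_sym sg).
have toz u : u \in z |: S -> connect (addE F x z) u x.
  rewrite !inE => /orP[/eqP->|uS].
    by apply: connect1; rewrite /addE /= eqxx !orbT.
  by apply: connect_subrel (sg_conn sg uS xS); apply: sub_addE.
move=> u v /toz ux /toz; rewrite (sym_connect_sym sF') => vx.
exact: connect_trans ux vx.
Qed.

(** After deleting uv every vertex is still joined to u or to v, and the new edge
    pw joins the two parts again. *)
Lemma subgraph_exchange S F u v p w : subgraph S F ->
  p \in S -> w \in S -> e p w -> v \in S -> F u v ->
  connect (delE F u v) p u -> connect (delE F u v) w v ->
  subgraph S (addE (delE F u v) p w).
Proof.
move=> sg pS wS epw vS Fuv pu wv; split.
- exact/addE_sym/delE_sym/(sg_sym sg).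
- move=> a b /or3P[/sub_delE/(sg_sub sg)//| |] /eqP[-> ->] //; by rewrite e_sym.
- by move=> a b /or3P[/sub_delE/(sg_in sg)//| |] /eqP[-> _].
have sF' := sym_connect_sym (addE_sym p w (delE_sym u v (sg_sym sg))).
have sub := @sub_addE _ (delE F u v) p w.
have vu : connect (addE (delE F u v) p w) v u.
  apply: connect_trans (connect_subrel sub pu).
  rewrite sF'; apply: connect_trans (connect_subrel sub wv).
  by apply: connect1; rewrite /addE /= eqxx !orbT.
have tou x : x \in S -> connect (addE (delE F u v) p w) x u.
  move=> xS; have [] := @connect_delE_dicho _ F u v x.
  - exact: (sg_conn sg) xS (sg_in sg Fuv).
  - exact: connect_subrel.
  - by move=> xv; apply: connect_trans (connect_subrel sub xv) vu.
move=> x y /tou xu /tou; rewrite sF' => uy; exact: connect_trans xu uy.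
Qed.

Lemma subgraph_delE S F u v : subgraph S F -> F u v ->
  connect (delE F u v) u v -> subgraph S (delE F u v).
Proof.
move=> sg Fuv uv; split.
- exact/delE_sym/(sg_sym sg).
- by move=> a b /sub_delE/(sg_sub sg).
- by move=> a b /sub_delE/(sg_in sg).
have tou x : x \in S -> connect (delE F u v) x v.
  move=> xS; have [xu|//] := @connect_delE_dicho _ F u v x
    (sg_conn sg xS (sg_in sg Fuv)).
  exact: connect_trans xu uv.
move=> x y /tou xv /tou; rewrite (sg_Esym _ _ sg) => vy; exact: connect_trans xv vy.
Qed.

Lemma min_bridges S F : subgraph S F ->
  (forall F', subgraph S F' -> subrel F' F -> darts F <= darts F') -> bridges F.
Proof.
move=> sg min u v Fuv; apply/negP => uv.
have := min _ (subgraph_delE sg Fuv uv) (@sub_delE _ F u v); rewrite leqNgt.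
by rewrite (darts_lt (@sub_delE _ F u v) (deg_delE_lt Fuv)).
Qed.

Lemma bridge_sides S F b a a' : subgraph S F -> bridges F ->
  F b a -> F b a' -> a != a' -> ~~ connect (delV F b) a a'.
Proof.
move=> sg br Fba Fba' aa'; apply: contra (br _ _ Fba) => aa.
apply: (@connect_trans _ _ a').
  apply: connect1; apply/and3P; split=> //; rewrite xpair_eqE ?eqxx /= 1?eq_sym //.
  by rewrite [a' == b]eq_sym (negPf (sg_neq sg Fba')) andbF.
rewrite (sg_Esym _ _ sg); exact: connect_subrel (@delV_delE _ F b a) aa.
Qed.

(** Walking away from b in a tree ends at a leaf: the part of the tree behind
    the next edge is strictly smaller. *)
Lemma leaf_behind S F b a : subgraph S F -> bridges F -> F b a ->
  exists2 x, leaf S F x & connect (delV F b) a x.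
Proof.
move=> sg br; have sF := sg_sym sg.
have [n] := ubnP #|[set v | connect (delV F b) a v]|.
elim: n a b => // n IHn a b lt_n Fba; have aS := sg_inr sg Fba.
have [d1|d2] := leqP (deg F a) 1; first by exists a.
have [a' [Faa' a'b]] := @deg_ge2 _ F a b d2.
have Fab : F a b by rewrite sF.
have a'Nb : ~~ connect (delV F a) a' b := bridge_sides sg br Faa' Fab a'b.
have sub v : connect (delV F a) a' v -> connect (delV F b) a v.
  move=> a'v; apply: (@connect_trans _ _ a').
    apply/connect1/and3P; split=> //; rewrite eq_sym; exact: (sg_neq sg Fba).
  apply: connect_subrel (connect_avoid a'v a'Nb); apply: delV_subrel.
  exact: sub_delV.
have [|//|x lx a'x] := IHn a' a; last by exists x => //; apply: sub.
rewrite -ltnS; apply: leq_trans lt_n; rewrite ltnS.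
apply/proper_card/properP; split.
  by apply/subsetP=> v; rewrite !inE; apply: sub.
exists a; rewrite !inE ?connect0 //; apply/negP => /connect_delVN aa'.
by have := sg_neq sg Faa'; rewrite aa' eqxx.
Qed.

(** At most one of the three branches at b leads to b'; each of the other two
    contains a leaf. *)
Lemma fork S F b b' : subgraph S F -> bridges F -> b' \in S -> b' != b ->
  2 < deg F b -> exists x y, [/\ leaf S F x, leaf S F y, x != y,
    ~~ connect (delV F b) x b' & ~~ connect (delV F b) y b'].
Proof.
move=> sg br b'S b'b d3; have symV := sg_Vsym b sg.
have bS : b \in S by apply: contraTT d3 => /(deg_out sg)->.
have [t [Ftb b't]] := connect_enter (sg_conn sg b'S bS) b'b.
have Fbt : F b t by rewrite (sg_sym sg).
have [a [a' [Fa Fa' at_ a't aa']]] := @deg_ge3 _ F b t d3.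
have [x lx ax] := leaf_behind sg br Fa; have [y ly ay] := leaf_behind sg br Fa'.
exists x, y; split=> //.
- apply: contraTneq ay => <-; apply/negP => a'x.
  have /negP := bridge_sides sg br Fa Fa' aa'; apply.
  by apply: connect_trans ax _; rewrite symV.
- apply/negP => xb'; have /negP := bridge_sides sg br Fa Fbt at_; apply.
  exact: connect_trans ax (connect_trans xb' b't).
- apply/negP => xb'; have /negP := bridge_sides sg br Fa' Fbt a't; apply.
  exact: connect_trans ay (connect_trans xb' b't).
Qed.

(** The leaves are taken beyond b away from b', and beyond b' away from b. *)
Lemma four_leaves S F b b' : subgraph S F -> bridges F -> b != b' ->
  2 < deg F b -> 2 < deg F b' -> exists x1 x2 x3 x4,
  [/\ uniq [:: x1; x2; x3; x4],
      forall x, x \in [:: x1; x2; x3; x4] -> leaf S F x &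
      forall x y, x \in [:: x1; x2] -> y \in [:: x3; x4] ->
        ~~ connect (delV F b) x y].
Proof.
move=> sg br bb' d d'.
have bS : b \in S by apply: contraTT d => /(deg_out sg)->.
have b'S : b' \in S by apply: contraTT d' => /(deg_out sg)->.
have b'b : b' != b by rewrite eq_sym.
have [x1 [x2 [l1 l2 x12 n1 n2]]] := fork sg br b'S b'b d.
have [x3 [x4 [l3 l4 x34 n3 n4]]] := fork sg br bS bb' d'.
have tob' x : x \in S -> ~~ connect (delV F b') x b -> connect (delV F b) x b'.
  by move=> xS; have [->|] := connect_first bb' (sg_conn sg xS bS).
have c3 := tob' _ (leaf_in l3) n3; have c4 := tob' _ (leaf_in l4) n4.
have sep x y : x \in [:: x1; x2] -> y \in [:: x3; x4] -> ~~ connect (delV F b) x y.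
  move=> x_in y_in; have xN : ~~ connect (delV F b) x b'.
    by move: x_in; rewrite !inE => /orP[]/eqP->.
  apply: contra xN => xy; apply: connect_trans xy _.
  by move: y_in; rewrite !inE => /orP[]/eqP->.
exists x1, x2, x3, x4; split=> //.
  have ne x y : x \in [:: x1; x2] -> y \in [:: x3; x4] -> x != y.
    by move=> xi yi; apply: contraNneq (sep _ _ xi yi) => ->.
  by rewrite /= !inE !negb_or x12 x34 !ne // !inE eqxx ?orbT.
by move=> x; rewrite !inE => /or4P[]/eqP->.
Qed.

Lemma clawP : claw_free e -> forall c x y z, e c x -> e c y -> e c z ->
  x != y -> x != z -> y != z -> [\/ e x y, e x z | e y z].
Proof.
move=> cf c x y z cx cy cz xy xz yz; apply: NNPP => none; apply: cf.
have [xyN xzN yzN] : [/\ e x y = false, e x z = false & e y z = false].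
  by split; apply/negP => ?; apply: none; [apply: Or31|apply: Or32|apply: Or33].
have ne a b : e a b -> (a == b) = false.
  by move=> eab; apply: contraTF eab => /eqP->; rewrite e_irr.
pose f (o : option 'I_3) := if o is Some i then nth c [:: x; y; z] i else c.
have ord3 (P : 'I_3 -> Prop) :
    P (inord 0) -> P (inord 1) -> P (inord 2) -> forall i, P i.
  move=> P0 P1 P2 [[|[|[|i]]] lti] //.
  - by move: P0; congr P; apply: val_inj; rewrite /= inordK.
  - by move: P1; congr P; apply: val_inj; rewrite /= inordK.
  - by move: P2; congr P; apply: val_inj; rewrite /= inordK.
exists f; split.
  move=> [i|] [j|] //=; [ | | ].
  - elim/ord3: i; elim/ord3: j; rewrite !inordK //= => /eqP;
    by rewrite ?(negPf xy) ?(negPf xz) ?(negPf yz) // eq_sym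
      ?(negPf xy) ?(negPf xz) ?(negPf yz).
  - by elim/ord3: i; rewrite !inordK //= => /eqP; rewrite eq_sym ne.
  - by elim/ord3: j; rewrite !inordK //= => /eqP; rewrite ne.
move=> [i|] [j|] //=; rewrite /K13 /=.
- elim/ord3: i; elim/ord3: j; rewrite !inordK //= ?e_irr //;
  by rewrite e_sym.
- by elim/ord3: i; rewrite !inordK //= e_sym.
- by elim/ord3: j; rewrite !inordK //= .
Qed.

End Subgraphs.

(** * From a dominating spider to the spanning tree *)

Section SpanningTree.
Variables (V : finType) (e : rel V).
Hypotheses (e_sym : symmetric e) (e_irr : irreflexive e).
Implicit Types (F t : rel V) (S : {set V}) (x y z c d : V).

(** Removing an edge of a cycle leaves its ends joined by the rest of it. *)
Lemma bridges_acyclic F : symmetric F -> bridges F -> acyclic F.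
Proof.
move=> sF br [|x [|y [|z r]]] // _ /andP[/= /andP[Fxy cyc] /and3P[xN yN _]].
have : path F y (rcons (z :: r) x) by [].
rewrite rcons_path => /andP[q_path]; set l := last _ _ => Flx.
have sD := sym_connect_sym (delE_sym x y sF).
case/negP: (br _ _ Fxy); rewrite sD; apply: (@connect_trans _ _ l).
  apply: connect_subrel (@delV_delE _ F x y) _; apply/connectP.
  by exists (z :: r) => //; apply: path_delV.
have ly : l != y by apply: contraNneq yN => <-; rewrite /l /= mem_last.
have lx : l != x.
  apply: contraNneq xN => <-; rewrite inE; apply/orP; right.
  by rewrite /l /= mem_last.
by apply/connect1/and3P; split=> //; rewrite xpair_eqE ?(negPf lx) ?(negPf ly).
Qed.

(** An inner vertex of a path has two neighbours on it, so it is not a leaf and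
    the path survives in the stem. *)
Lemma stem_connected t (x y : stem_vertex t) : symmetric t ->
  connect t (val x) (val y) -> connect (@stem V t) x y.
Proof.
move=> st /connectP[p0 p0P]; case: (shortenP p0P) => p + up _ {p0 p0P}.
move: up; elim: p x => [|z p IHp] x /= up.
  by move=> _ /val_inj->; apply: connect0.
case/andP=> txz pP def_y; case/andP: (up) => xN up'.
have z_stem : ~~ is_leaf t z.
  case: p {IHp up up'} xN pP def_y => [|w p] /= xN pP def_y.
    by rewrite -def_y; exact: (valP y).
  apply/negP => /eqP dz; case/andP: pP => tzw _; move: xN.
  have tzx : t z (val x) by rewrite st.
  have dz1 : deg t z <= 1 by rewrite dz.
  by rewrite (deg_le1 dz1 tzx tzw) !inE eqxx orbT.
have := IHp (exist _ z z_stem) up' pP def_y; apply: connect_trans.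
exact: connect1.
Qed.

Lemma subgraph_tree t : 0 < #|V| -> subgraph e setT t -> bridges t ->
  is_tree t.
Proof.
move=> V_gt0 sg br; split.
- exact: sg_sym sg.
- by move=> x; apply/negP => /(sg_sub sg); rewrite e_irr.
- by split=> // x y; apply: (sg_conn sg); rewrite inE.
- exact: bridges_acyclic (sg_sym sg) br.
Qed.

(** Hang each vertex outside S on a neighbour in S and take a minimal connected
    spanning part t of the result.  All vertices outside S are leaves of t, so
    the stem of t has only edges of F. *)
Lemma spanning_tree_of_spider S F : 0 < #|V| -> subgraph e S F -> dominating e S ->
  #|branches F| <= 1 -> exists t : rel V, spanning_tree e t /\ stem_is_spider t.
Proof.
move=> V_gt0 sg dom br1; have sF := sg_sym sg.
pose p v := odflt v [pick u | (u \in S) && e u v].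
have pP v : v \notin S -> p v \in S /\ e (p v) v.
  move=> vS; rewrite /p; case: pickP => [u /andP[]|] //= none.
  case: (dom v) => [vS'|[u uS euv]]; first by rewrite vS' in vS.
  by have := none u; rewrite uS euv.
pose U := [rel x y | [|| F x y, (x \notin S) && (y == p x)
                              | (y \notin S) && (x == p y)]].
have sU : symmetric U.
  by move=> x y; rewrite /U /= sF; congr (_ || _); apply: orbC.
have sgU : subgraph e setT U.
  split=> //.
  - move=> x y /or3P[/(sg_sub sg)//| |] /andP[/pP[_ exy] /eqP->] //.
    by rewrite e_sym.
  have toS x : exists2 s, s \in S & connect U x s.
    have [xS|xS] := boolP (x \in S); first by exists x.
    by exists (p x); [case: (pP x xS) | apply: connect1; rewrite /U /= xS eqxx orbT].
  move=> x y _ _; have [s sS xs] := toS x; have [s' s'S ys'] := toS y.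
  apply: connect_trans xs _; rewrite (sym_connect_sym sU).
  apply: connect_trans ys' _; apply: connect_subrel (sg_conn sg s'S sS).
  by move=> a b Fab; rewrite /U /= Fab.
pose P t := subgraph e setT t /\ subrel t U.
have [|t [[sgt tU] t_min]] := @exists_minimal _ P (@darts V).
  by exists U; split.
have brt : bridges t.
  apply: (min_bridges sgt) => F' sgF' F't; apply: t_min; split=> //.
  by move=> x y /F't /tU.
have st := sg_sym sgt.
have tree_t := subgraph_tree V_gt0 sgt brt.
exists t; split; first by split=> //; apply: sg_sub sgt.
have out_leaf v w : v \notin S -> t v w -> is_leaf t v.
  move=> vS tvw; rewrite /is_leaf eqn_leq (deg_gt0 tvw) andbT.
  have tP u : t v u -> u = p v.
    case/tU/or3P=> [/(sg_in sg) vS'|/andP[_ /eqP]|/andP[uS /eqP vp]] //.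
      by rewrite vS' in vS.
    by case: (pP u uS) => pS _; rewrite -vp (negPf vS) in pS.
  rewrite -(cards1 (p v)); apply/subset_leq_card/subsetP=> u; rewrite !inE.
  by move/tP->.
have stem_F (x y : stem_vertex t) : stem x y -> F (val x) (val y).
  move=> txy; have tyx : t (val y) (val x) by rewrite st.
  have xS : val x \in S.
    by apply: contraT => /out_leaf/(_ txy); rewrite (negPf (valP x)).
  have yS : val y \in S.
    by apply: contraT => /out_leaf/(_ tyx); rewrite (negPf (valP y)).
  by have /or3P[//| |] := tU _ _ txy; rewrite ?xS ?yS.
have [s0|s_gt0] := posnP #|stem_vertex t|; [by left | right; split].
  case: tree_t => _ irr_t [_ conn_t] acyc_t; split.
  - by move=> x y; apply: st.
  - by move=> x; apply: irr_t.
  - by split=> // x y; apply: stem_connected.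
  move=> c c3 /andP[cyc uc]; apply: (acyc_t (map val c)); first by rewrite size_map.
  by rewrite /ucycle (map_inj_uniq val_inj) uc andbT cycle_map.
apply: leq_trans br1; rewrite -(card_imset _ val_inj).
apply/subset_leq_card/subsetP=> _ /imsetP[x x_br ->].
rewrite inE; rewrite inE in x_br.
apply: leq_trans x_br _; rewrite /deg -(card_imset _ val_inj).
apply/subset_leq_card/subsetP=> _ /imsetP[y xy ->]; rewrite inE.
by apply: stem_F; rewrite inE in xy.
Qed.

(** Appending vertices one at a time to the free end of a leg creates no vertex
    of degree above two except possibly the centre c. *)
Lemma grow_leg S F c x p : subgraph e S F -> c \in S ->
  (forall v, v != c -> deg F v <= 2) -> x \in S -> (x != c -> deg F x <= 1) ->
  path e x p -> uniq p -> (forall v, v \in p -> v \notin S) ->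
  exists F', subgraph e (S :|: [set v in p]) F' /\
    forall v, v != c -> deg F' v <= 2.
Proof.
elim: p S F x => [|z p IHp] S F x sg cS d2 xS dx /=.
  move=> _ _ _; exists F; split=> //.
  by rewrite (_ : S :|: _ = S) //; apply/setP=> v; rewrite !inE orbF.
case/andP=> exz zp /andP[zNp up] out.
have zS : z \notin S by apply: out; rewrite inE eqxx.
have sg' := subgraph_pendant e_sym sg xS zS exz.
have xz : x != z by apply: contraNneq zS => <-.
have le v := deg_addE F v xz.
have dz : deg (addE F x z) z <= 1.
  by apply: leq_trans (le z) _; rewrite (deg_out sg zS) eqxx eq_sym (negPf xz).
have d2' v : v != c -> deg (addE F x z) v <= 2.
  move=> vc; have [->|vz] := eqVneq v z; first exact: leq_trans dz _.
  apply: leq_trans (le v) _; rewrite (negPf vz) addn0.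
  have [vx|vx] := eqVneq v x; last by rewrite addn0 d2.
  by rewrite addn1 ltnS vx dx // -vx.
have cS' : c \in z |: S by rewrite !inE cS orbT.
have zS' : z \in z |: S by rewrite !inE eqxx.
have out' v : v \in p -> v \notin z |: S.
  move=> vp; rewrite !inE negb_or out ?inE ?vp ?orbT // andbT.
  by apply: contraNneq zNp => <-.
have [F' [sg1 d1]] := IHp _ _ z sg' cS' d2' zS' (fun=> dz) zp up out'.
exists F'; split=> //; congr (subgraph e _ F'): sg1.
by apply/setP=> v; rewrite !inE orbCA orbA.
Qed.

(** A spider with centre c and three legs, each leg listed from the centre
    outwards; empty legs give paths. *)
Definition spider_on c (l1 l2 l3 : seq V) :=
  [/\ path e c l1, path e c l2, path e c l3 & uniq (c :: l1 ++ l2 ++ l3)].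

Lemma spider_subgraph c l1 l2 l3 : spider_on c l1 l2 l3 ->
  exists F, subgraph e [set v in c :: l1 ++ l2 ++ l3] F /\ #|branches F| <= 1.
Proof.
case=> p1 p2 p3; rewrite /= !mem_cat !negb_or !cat_uniq has_cat negb_or.
case/andP=> /and3P[c1 c2 c3] /and3P[u1 /andP[/hasPn d12 /hasPn d13]].
case/and3P=> u2 /hasPn d23 u3.
have sg0 : subgraph e [set c] (fun _ _ => false).
  by split=> // x y; rewrite !inE => /eqP-> /eqP->; apply: connect0.
have deg0 v : v != c -> deg (fun _ _ : V => false) v <= 2.
  by rewrite /deg (_ : [set _ | _] = set0) ?cards0 //; apply/setP=> w; rewrite !inE.
have cc : c \in [set c] by rewrite inE.
have cNc (n : nat) : c != c -> n <= 1 by rewrite eqxx.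
have ne (l : seq V) v : c \notin l -> v \in l -> v != c.
  by move=> cl; apply: contraTneq => ->.
have [v v1|F1 [sg1 d1]] := grow_leg sg0 cc deg0 cc (cNc _) p1 u1.
  by rewrite inE (ne l1 v).
have cS1 : c \in [set c] :|: [set v in l1] by rewrite !inE eqxx.
have [v v2|F2 [sg2 d2]] := grow_leg sg1 cS1 d1 cS1 (cNc _) p2 u2.
  by rewrite !inE negb_or (ne l2) //; apply: d12.
have cS2 : c \in [set c] :|: [set v in l1] :|: [set v in l2] by rewrite !inE eqxx.
have [v v3|F3 [sg3 d3]] := grow_leg sg2 cS2 d2 cS2 (cNc _) p3 u3.
  by rewrite !inE !negb_or (ne l3) //= d13 //; apply: d23.
exists F3; split.
  congr (subgraph e _ F3): sg3.
  by apply/setP=> v; rewrite !inE !mem_cat !orbA.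
rewrite -(cards1 c); apply/subset_leq_card/subsetP=> v; rewrite !inE.
by apply: contraTT => /d3; rewrite -leqNgt.
Qed.

End SpanningTree.

(** * Independent sets in a claw-free graph *)

Section Independent.
Variables (V : finType) (e : rel V).
Hypotheses (e_sym : symmetric e) (e_irr : irreflexive e).
Hypothesis claw : claw_free e.
Implicit Types (S : {set V}) (X : seq V).

Lemma two_of_count (X : seq V) (P : pred V) : uniq X -> count P X = 2 ->
  exists p q, [/\ p \in X, q \in X, p != q, P p & P q] /\
    forall x, x \in X -> P x -> x \in [:: p; q].
Proof.
move=> uX; rewrite -size_filter => s2.
have uN : uniq [seq x <- X | P x] := filter_uniq _ uX.
have inN x : x \in [seq x <- X | P x] = P x && (x \in X) by rewrite mem_filter.
case: [seq x <- X | P x] s2 uN inN => [|p [|q []]] //= _.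
rewrite inE andbT => pq inN; exists p, q.
have := inN p; have := inN q; rewrite !inE !eqxx orbT /=.
move=> /esym/andP[Pq qX] /esym/andP[Pp pX]; split=> // x xX Px.
by rewrite inN Px.
Qed.

Definition independent (X : seq V) :=
  forall x y, x \in X -> y \in X -> ~~ e x y.

Lemma no_three X a x y z : independent X -> uniq [:: x; y; z] ->
  x \in X -> y \in X -> z \in X -> e a x -> e a y -> ~~ e a z.
Proof.
move=> indep; rewrite /= !inE negb_or => /and3P[/andP[xy xz] yz _] xX yX zX ax ay.
apply/negP => az; have [] := clawP e_sym e_irr claw ax ay az xy xz yz;
by apply/negP; apply: indep.
Qed.

Lemma count_le2 X a : independent X -> uniq X -> count (e a) X <= 2.
Proof.
move=> indep uX; rewrite leqNgt -size_filter; apply/negP => s3.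
have : uniq [seq x <- X | e a x] := filter_uniq _ uX.
have : all (fun x => e a x && (x \in X)) [seq x <- X | e a x].
  by apply/allP=> x; rewrite mem_filter.
case: [seq x <- X | e a x] s3 => [|x [|y [|z l]]] // _ all_l uniq_l.
have /and4P[/andP[ax xX] /andP[ay yX] /andP[az zX] _] := all_l.
have : uniq ([:: x; y; z] ++ l) := uniq_l; rewrite cat_uniq => /andP[u3 _].
by have := no_three indep u3 xX yX zX ax ay; rewrite az.
Qed.

(** Otherwise a would be the centre of a claw with ends p, q and b. *)
Lemma second_centre X a b p q : independent X -> b \notin X -> e a b ->
  p \in X -> q \in X -> p != q -> e a p -> e a q -> e b p || e b q.
Proof.
move=> indep bX ab pX qX pq ap aq.
have pb : p != b by apply: contraNneq bX => <-.
have qb : q != b by apply: contraNneq bX => <-.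
rewrite ![e b _]e_sym.
have [epq|->|->] := clawP e_sym e_irr claw ap aq ab pq pb qb; rewrite ?orbT //.
by have := indep p q pX qX; rewrite epq.
Qed.

(** Each of a and b has at most two neighbours in X, so otherwise the neighbours
    of a would be two vertices p, q and those of b the other two; but b is also
    adjacent to p or to q. *)
Lemma not_two_centres X a b : uniq X -> size X = 4 -> independent X ->
  b \notin X -> e a b -> ~ (forall x, x \in X -> e a x || e b x).
Proof.
move=> uX sX indep bX ab nbr.
have a2 := count_le2 a indep uX; have b2 := count_le2 b indep uX.
have ca : count (e a) X = 2.
  apply/eqP; rewrite eqn_leq a2 -(leq_add2r (count (e b) X)) -count_predUI.
  apply: leq_trans (leq_trans (_ : _ <= 4) _) (leq_addr _ _).
    by rewrite (leq_add2l 2 _ 2).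
  have : all (predU (e a) (e b)) X by apply/allP.
  by rewrite all_count sX => /eqP->.
have [p [q [[pX qX pq ap aq] _]]] := two_of_count uX ca.
have [|r [s [[rX sX' rs ar as_] _]]] := two_of_count (P := predC (e a)) uX.
  by apply/eqP; rewrite -(eqn_add2l 2) -{1}ca count_predC sX.
have br : e b r by have := nbr r rX; rewrite (negPf ar).
have bs : e b s by have := nbr s sX'; rewrite (negPf as_).
have three t : t \in X -> e a t -> e b t -> False.
  move=> tX at_ bt; have := @no_three X b t r s indep _ tX rX sX' bt br.
  rewrite bs /= !inE negb_or rs !andbT => H; apply/notF/H.
  by apply/andP; split; apply: contraTneq at_ => ->.
by case/orP: (second_centre indep bX ab pX qX pq ap aq); apply: three.
Qed.

(** Seven vertices: four independent ones, each adjacent to a clique of the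
    other three.  Each of u, v, w has at most two neighbours in X.  If u and w
    are not adjacent, then X splits into two neighbours of u and two of w, v is
    adjacent to one of either pair, and a path runs through all seven vertices.
    If u, v, w form a triangle, one of them, say a, has two neighbours p, q in X,
    and each of the others is adjacent to p or q and to exactly one of the two
    remaining vertices of X; this gives a path, or a spider centred at p or q. *)
Lemma cover_by_spider S (X : seq V) u v w :
  uniq X -> size X = 4 -> uniq [:: u; v; w] ->
  (forall x, x \in X -> x \notin [:: u; v; w]) ->
  {subset S <= X ++ [:: u; v; w]} ->
  independent X ->
  (forall x, x \in X -> [|| e u x, e v x | e w x]) ->
  (forall x a b, x \in X -> a \in [:: u; v; w] -> b \in [:: u; v; w] ->
    a != b -> e a x -> e b x -> e a b) ->
  e u v -> e v w ->
  exists c l1 l2 l3, spider_on e c l1 l2 l3 /\ {subset S <= c :: l1 ++ l2 ++ l3}.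
Proof.
move=> uX sX uI disj cover indep nbr clique euv evw.
have [uv uw vw] : [/\ u != v, u != w & v != w].
  by move: uI; rewrite /= !inE negb_or => /and3P[/andP[-> ->] ->].
have XI x a : x \in X -> a \in [:: u; v; w] -> x != a.
  by move=> /disj + aI; apply: contraNneq => ->.
have [uI' vI' wI'] : [/\ u \in [:: u; v; w], v \in [:: u; v; w] & w \in [:: u; v; w]].
  by rewrite !inE !eqxx !orbT.
have T3 a x y z := @no_three X a x y z indep.
have sN a := count_le2 a indep uX.
have pair P := @two_of_count X P uX.
have cover3 (P Q R : pred V) : (forall x, x \in X -> [|| P x, Q x | R x]) ->
    4 <= count P X + count Q X + count R X.
  rewrite -sX; elim: (X) => //= x l IHl PQR.
  rewrite (addnACA (P x)) (addnACA (P x + Q x)) -add1n leq_add //; last first.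
    by apply: IHl => y yl; apply: PQR; rewrite inE yl orbT.
  by have := PQR x (mem_head _ _); case: (P x); case: (Q x); case: (R x).
have finish c l1 l2 l3 : path e c l1 -> path e c l2 -> path e c l3 ->
    size (c :: l1 ++ l2 ++ l3) = 7 ->
    {subset X <= c :: l1 ++ l2 ++ l3} -> u \in c :: l1 ++ l2 ++ l3 ->
    v \in c :: l1 ++ l2 ++ l3 -> w \in c :: l1 ++ l2 ++ l3 ->
    exists c l1 l2 l3, spider_on e c l1 l2 l3 /\ {subset S <= c :: l1 ++ l2 ++ l3}.
  move=> p1 p2 p3 s7 subX ul vl wl; exists c, l1, l2, l3.
  have sub : {subset X ++ [:: u; v; w] <= c :: l1 ++ l2 ++ l3}.
    move=> x; rewrite mem_cat => /orP[/subX //|].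
    by rewrite !inE => /or3P[]/eqP->.
  split; last by move=> x /cover /sub.
  split=> //; apply: leq_size_uniq sub _; last by rewrite s7 size_cat sX.
  rewrite cat_uniq uX uI andbT; apply/hasPn=> x xI.
  by apply/negP => /disj; rewrite xI.
have evu : e v u by rewrite e_sym. have ewv : e w v by rewrite e_sym.
have sym a x : e a x -> e x a by rewrite e_sym.
have side a b p q : b \in [:: u; v; w] -> e a b ->
    p \in X -> q \in X -> p != q -> e a p -> e a q -> e b p || e b q.
  by move=> bI; apply: second_centre => //; apply: contraTN bI => /disj.
(* Without the edge uw, a neighbour of v in X is adjacent to u or w, by the
   claw at v. *)
have [euw|euw] := boolP (e u w); last first.
  have ends x : x \in X -> [|| e u x, e w x | pred0 x].
    move=> xX; rewrite orbF; case/or3P: (nbr x xX) => [->|vx|->]; rewrite ?orbT //.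
    have ux : u != x by rewrite eq_sym XI. have wx : w != x by rewrite eq_sym XI.
    have [|->|->] := clawP e_sym e_irr claw evu evw vx uw ux wx; rewrite ?orbT //.
    by move=> uw'; rewrite uw' in euw.
  have := cover3 _ _ _ ends; rewrite count_pred0 addn0 => sum4.
  have c_u : count (e u) X = 2.
    by apply/eqP; rewrite eqn_leq sN -(leq_add2r 2) (leq_trans sum4) ?leq_add2l.
  have c_w : count (e w) X = 2.
    by apply/eqP; rewrite eqn_leq sN -(leq_add2l 2) (leq_trans sum4) ?leq_add2r.
  have near a : a \in [:: u; w] -> exists p q, [/\ e a p, e a q, e v p &
      forall x, x \in X -> e a x -> x \in [:: p; q]].
    move=> a_in; have [aI ca av] : [/\ a \in [:: u; v; w], count (e a) X = 2 & e a v].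
      by move: a_in; rewrite !inE => /orP[]/eqP->; rewrite ?eqxx ?orbT.
    have [p [q [[pX qX pq ap aq] Npq]]] := pair _ ca.
    case/orP: (side a v p q vI' av pX qX pq ap aq) => [vp|vq]; first by exists p, q.
    by exists q, p; split=> // x xX /(Npq x xX); rewrite !inE orbC.
  have [|p [q [up uq vp Nu]]] := near u; rewrite ?inE ?eqxx //.
  have [|r [s [wr ws vr Nw]]] := near w; rewrite ?inE ?eqxx ?orbT //.
  apply: (finish q [:: u; p; v; r; w; s] [::] [::]) => //=; rewrite ?inE ?eqxx ?orbT //.
    by rewrite (sym u q uq) up (sym v p vp) vr (sym w r wr) ws.
  move=> x xX; case/or3P: (ends x xX) => // [/(Nu x xX)|/(Nw x xX)];
  by rewrite !inE => /orP[]->; rewrite ?orbT.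
have triangle a b c : perm_eq [:: a; b; c] [:: u; v; w] -> e a b -> e a c ->
    count (e a) X = 2 ->
    exists c l1 l2 l3, spider_on e c l1 l2 l3 /\ {subset S <= c :: l1 ++ l2 ++ l3}.
  move=> /perm_mem memI ab ac ca.
  have [aI bI cI] : [/\ a \in [:: u; v; w], b \in [:: u; v; w] & c \in [:: u; v; w]].
    by rewrite -!memI !inE !eqxx !orbT.
  have [p [q [[pX qX pq ap aq] Npq]]] := pair _ ca.
  have [|r [s [[rX sX' rs ar as_] Nrs]]] := pair (predC (e a)).
    by apply/eqP; rewrite -(eqn_add2l 2) -{1}ca count_predC sX.
  rewrite /= in ar as_.
  have bpq := side a b p q bI ab pX qX pq ap aq.
  have cpq := side a c p q cI ac pX qX pq ap aq.
  have bc x : x \in X -> ~~ e a x -> e b x || e c x.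
    move=> xX ax; have : has (fun d => e d x) [:: u; v; w] by rewrite /= orbF nbr.
    by rewrite -(eq_has_r memI) /= (negPf ax) orbF.
  have not_both d : e d p || e d q -> e d r -> ~~ e d s.
    have three t : t \in X -> e a t -> e d t -> e d r -> ~~ e d s.
      move=> tX at_; apply: T3 => //; rewrite /= !inE negb_or rs !andbT.
      by apply/andP; split; apply: contraTneq at_ => ->.
    by case/orP=> dt; [apply: (three p) | apply: (three q)].
  have last_step r' s' : r' \in X -> s' \in X -> e b r' -> e c s' ->
      (forall x, x \in X -> ~~ e a x -> x \in [:: r'; s']) ->
      exists c l1 l2 l3, spider_on e c l1 l2 l3 /\ {subset S <= c :: l1 ++ l2 ++ l3}.
    move=> rX' sX'' br cs Nrs'.
    have cov (l : seq V) : all (mem l) [:: a; b; c; p; q; r'; s'] ->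
        [/\ {subset X <= l}, u \in l, v \in l & w \in l].
      move=> /= /and5P[al bl cl pl /and4P[ql rl sl _]].
      have abc x : x \in [:: u; v; w] -> x \in l.
        by rewrite -memI !inE => /or3P[]/eqP->.
      split; rewrite ?abc // => x xX.
      have [/(Npq x xX)|/(Nrs' x xX)] := boolP (e a x);
      by rewrite !inE => /orP[]/eqP->.
    have [pa qa] := (sym _ _ ap, sym _ _ aq); have rb := sym _ _ br.
    case/orP: bpq => bp; case/orP: cpq => cp; have pc := sym _ _ cp; have pb := sym _ _ bp.
    - have [|sub ul vl wl] := cov (p :: [:: a; q] ++ [:: b; r'] ++ [:: c; s']).
        by rewrite /= !inE !eqxx !orbT.
      by apply: (finish p [:: a; q] [:: b; r'] [:: c; s']) => //=;
        rewrite ?pa ?pb ?pc ?aq ?br ?cs.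
    - have [|sub ul vl wl] := cov [:: r'; b; p; a; q; c; s'].
        by rewrite /= !inE !eqxx !orbT.
      by apply: (finish r' [:: b; p; a; q; c; s'] [::] [::]) => //=;
        rewrite rb bp pa aq pc cs.
    - have [|sub ul vl wl] := cov [:: r'; b; q; a; p; c; s'].
        by rewrite /= !inE !eqxx !orbT.
      by apply: (finish r' [:: b; q; a; p; c; s'] [::] [::]) => //=;
        rewrite rb bp qa ap pc cs.
    - have [|sub ul vl wl] := cov (q :: [:: a; p] ++ [:: b; r'] ++ [:: c; s']).
        by rewrite /= !inE !eqxx !orbT.
      by apply: (finish q [:: a; p] [:: b; r'] [:: c; s']) => //=;
        rewrite ?qa ?pb ?pc ?ap ?br ?cs.
  case/orP: (bc r rX ar) => [br|cr].
    apply: (last_step r s) => //.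
    by have := bc s sX' as_; rewrite (negPf (not_both b bpq br)).
  apply: (last_step s r) => // [|x xX ax]; last first.
    by have := Nrs x xX ax; rewrite !inE orbC.
  by have := bc s sX' as_; rewrite (negPf (not_both c cpq cr)) orbF.
have := cover3 _ _ _ nbr => sum4.
have [c_u|c_u] := eqVneq (count (e u) X) 2.
  exact: (triangle u v w).
have [c_v|c_v] := eqVneq (count (e v) X) 2.
  by apply: (triangle v u w) => //; apply/permPl/(perm_catCA [:: v] [:: u] [:: w]).
apply: (triangle w u v) => //; first exact/permPl/(perm_catC [:: w] [:: u; v]).
  exact: sym.
have le1 z : count (e z) X != 2 -> count (e z) X <= 1.
  by move=> ne2; rewrite -ltnS ltn_neqAle ne2 sN.
apply/eqP; rewrite eqn_leq sN -(leq_add2l 2) (leq_trans sum4) // leq_add2r.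
by rewrite (leq_add (le1 u c_u) (le1 v c_v)).
Qed.

End Independent.

(** * Dominating subgraphs of least excess *)

Section LeastExcess.
Variables (V : finType) (e : rel V).
Hypotheses (e_sym : symmetric e) (e_irr : irreflexive e).
Hypothesis claw : claw_free e.
Implicit Types (F : rel V) (S : {set V}) (x y z c d : V).

Variable k : nat.
Hypothesis k_gt0 : 0 < k.
Hypothesis k_min : forall S F, subgraph e S F -> dominating e S -> k <= excess F.

(** Since k is the least excess of a dominating connected subgraph, these are
    the subgraphs for which it is attained.  An exchange only has to keep the
    excess from growing. *)
Record optimal S F : Prop := Optimal {
  opt_sg : subgraph e S F;
  opt_dom : dominating e S;
  opt_excess : excess F <= k }.

Lemma optimal_tight S F F' : optimal S F -> subgraph e S F' -> ~ excess F' < excess F.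
Proof.
case=> _ domS ex_le /k_min/(_ domS) k_le lt.
by have := leq_trans lt ex_le; rewrite ltnNge k_le.
Qed.

(** Adding the edge ab raises no degree above two and closes a cycle with the
    F-path from a to b.  If that path meets a branch vertex u, deleting the edge
    of the cycle that enters u lowers the excess; if it does not, the path is all
    of S and the excess is zero. *)
Lemma leaf_nonadj S F a b : optimal S F -> leaf S F a -> leaf S F b -> a != b ->
  ~~ e a b.
Proof.
move=> ad [aS da] [bS db] ab; apply/negP => eab; have sg := opt_sg ad.
have sF := sg_sym sg.
have /connectP[p0 p0F def_b0] := sg_conn sg aS bS.
case: (shortenP p0F) def_b0 => p pF up _ def_b {p0 p0F}.
have [/hasP[u up' u3]|no_branch] := boolP (has (fun u => 2 < deg F u) p).
  have ua : u != a by apply: contraTneq u3 => ->; rewrite -leqNgt ltnW // ltnS.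
  have ub : u != b by apply: contraTneq u3 => ->; rewrite -leqNgt ltnW // ltnS.
  move: up pF def_b; case/splitPr: p / up' => p1 p2; set w := last a p1.
  rewrite -cat_cons cat_uniq => /and3P[_ disj _].
  rewrite cat_path last_cat /= -/w => /and3P[p1F Fwu p2F] def_b.
  have uNp1 : u \notin a :: p1.
    by apply: contra disj => up1; apply/hasP; exists u => //; apply: mem_head.
  have wNp2 : w \notin u :: p2.
    by apply: contra disj => wp2; apply/hasP; exists w => //; apply: mem_last.
  have aw : connect (delE F u w) a w.
    apply: connect_subrel (@delV_delE _ F u w) _; apply/connectP.
    by exists p1 => //; apply: path_delV.
  have bu : connect (delE F u w) b u.
    rewrite (sg_Esym _ _ sg) def_b.
    apply: connect_subrel (@delV_delEr _ F u w) _; apply/connectP.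
    by exists p2 => //; apply: path_delV.
  have Fuw : F u w by rewrite sF.
  have sg' : subgraph e S (addE (delE F u w) b a).
    apply: (subgraph_exchange e_sym sg) => //; first by rewrite e_sym.
    exact: (sg_in sg Fwu).
  apply: (optimal_tight ad sg'); have ba : b != a by rewrite eq_sym.
  have le x := leq_trans (deg_addE (delE F u w) x ba)
    (leq_add (leq_add (deg_subrel x (@sub_delE _ F u w)) (leqnn _)) (leqnn _)).
  apply: (excess_lt (u := u)) => //.
    move=> x; apply: leq_trans (le x) _.
    rewrite leq_max; have [->|xb] := eqVneq x b.
      by rewrite (negPf ba) addn0 addn1 ltnS db.
    have [->|xa] := eqVneq x a; first by rewrite addn0 addn1 ltnS da.
    by rewrite !addn0 leqnn orbT.
  apply: leq_ltn_trans (deg_addE _ _ ba) _.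
  by rewrite (negPf ua) (negPf ub) !addn0 deg_delE_lt.
have {no_branch} d2 v : v \in p -> deg F v <= 2.
  by move=> vp; rewrite leqNgt; apply: contra no_branch => ?; apply/hasP; exists v.
have [u u3] : exists u, 2 < deg F u.
  by apply: excess_gt0; apply: leq_trans k_gt0 (k_min sg (opt_dom ad)).
have uS : u \in S by apply: contraTT u3 => /(deg_out sg) ->.
have : u \in a :: p.
  elim/connect_indr: (sg_conn sg aS uS) => [|y z _ yp Fyz]; first exact: mem_head.
  move: yp; rewrite inE => /orP[/eqP ya|yp]; last first.
    by apply: (path_closed sF pF up) yp Fyz => //; rewrite -def_b.
  case: p pF def_b {up d2} => [|t p] /= pF def_b; first by rewrite def_b eqxx in ab.
  case/andP: pF => Fat _; rewrite ya in Fyz.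
  by rewrite (deg_le1 da Fyz Fat) !inE eqxx orbT.
rewrite inE => /orP[/eqP ua|/d2]; last by rewrite leqNgt u3.
by rewrite ua ltnNge (leq_trans da) in u3.
Qed.

(** Only the leaf p gains a degree, from one to two; v loses the edge uv before
    it receives the edge pv. *)
Lemma optimal_swap S F p u v : optimal S F -> leaf S F p -> F u v -> e p v ->
  connect (delE F u v) p u ->
  optimal S (addE (delE F u v) p v) /\
  forall x, x != p -> deg (addE (delE F u v) p v) x <= deg F x.
Proof.
move=> ad [pS dp] Fuv epv pu; have sg := opt_sg ad; have sF := sg_sym sg.
have pv : p != v by apply: contraTneq epv => ->; rewrite e_irr.
pose F' := addE (delE F u v) p v.
have vS := sg_inr sg Fuv.
have sg' : subgraph e S F' by apply: (subgraph_exchange e_sym sg).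
have deg_x x : x != p -> deg F' x <= deg F x.
  move=> xp; apply: leq_trans (deg_addE _ _ pv) _; rewrite (negPf xp) addn0.
  have [->|_] := eqVneq x v; first by rewrite addn1 deg_delE_ltr.
  by rewrite addn0; apply/deg_subrel/sub_delE.
split=> //; split=> //; first exact: opt_dom ad.
apply: leq_trans (excess_le _) (opt_excess ad) => x; rewrite leq_max.
have [->|/deg_x->] := eqVneq x p; last by rewrite orbT.
apply/orP; left; apply: leq_trans (deg_addE _ _ pv) _; rewrite eqxx (negPf pv).
rewrite addn0 addn1 ltnS; apply: leq_trans dp.
exact: deg_subrel (@sub_delE _ F u v).
Qed.

(** Exchanging cs for ps would lower the degree of c.  If c was a branch vertex
    the excess drops; otherwise c becomes a leaf, adjacent to the leaf q. *)
Lemma no_swap S F p q c s : optimal S F -> leaf S F p -> leaf S F q -> p != q ->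
  e c p -> e c q -> F c s -> e s p -> ~~ connect (delE F c s) p c.
Proof.
move=> ad lp lq pq ecp ecq Fcs esp; apply/negP => pc.
have eps : e p s by rewrite e_sym.
have [ad' deg_x] := optimal_swap ad lp Fcs eps pc.
set F' := addE _ _ _ in ad' deg_x.
have ne x y : e x y -> x != y by apply: contraTneq => ->; rewrite e_irr.
have cs : c != s := sg_neq e_irr (opt_sg ad) Fcs.
have deg_c : deg F' c < deg F c.
  apply: leq_ltn_trans (deg_addE _ _ (ne _ _ eps)) _.
  by rewrite (negPf (ne _ _ ecp)) (negPf cs) !addn0 deg_delE_lt.
have [c3|c2] := leqP 3 (deg F c).
  have := optimal_tight ad (opt_sg ad'); apply; apply: (excess_lt _ c3 deg_c) => x.
  rewrite leq_max; have [->|/deg_x->] := eqVneq x p; last by rewrite orbT.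
  apply/orP; left; apply: leq_trans (deg_addE _ _ (ne _ _ eps)) _.
  rewrite eqxx (negPf (ne _ _ eps)) addn0 addn1 ltnS.
  by apply: leq_trans (leaf_deg lp); apply: deg_subrel (@sub_delE _ F c s).
have lc : leaf S F' c.
  by split; [exact: (sg_in (opt_sg ad) Fcs) | rewrite -ltnS (leq_trans deg_c)].
have lq' : leaf S F' q.
  split; first exact: leaf_in lq.
  by apply: leq_trans (deg_x _ _) (leaf_deg lq); rewrite eq_sym.
by have := leaf_nonadj ad' lc lq' (ne _ _ ecq); rewrite ecq.
Qed.

(** By the absence of a claw at c, its neighbour s is adjacent to p or to q, so
    one of the two exchanges of [no_swap] is available. *)
Lemma cut_edge S F p q c s : optimal S F -> leaf S F p -> leaf S F q -> p != q ->
  e c p -> e c q -> F c s ->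
  ~~ (connect (delE F c s) p c && connect (delE F c s) q c).
Proof.
move=> ad lp lq pq ecp ecq Fcs; apply/negP => /andP[pc qc].
have sg := opt_sg ad; have sF := sg_sym sg.
(* If s were x, deleting its only edge cs would isolate x. *)
have ns x : leaf S F x -> e c x -> connect (delE F c s) x c -> s != x.
  move=> lx ecx xc; apply: contraTneq xc => sx; rewrite -sx in lx *.
  apply/negP => /connectP[[|t r] /=].
    by move=> _ cs; have := sg_neq e_irr sg Fcs; rewrite cs eqxx.
  case/andP=> /and3P[Fst]; rewrite !xpair_eqE => _.
  have -> : t = c by apply: deg_le1 (leaf_deg lx) Fst _; rewrite sF.
  by rewrite !eqxx.
have sp := ns _ lp ecp pc; have sq := ns _ lq ecq qc.
have [esp|esq|epq] := clawP e_sym e_irr claw (sg_sub sg Fcs) ecp ecq sp sq pq.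
- by have := no_swap ad lp lq pq ecp ecq Fcs esp; rewrite pc.
- by have := no_swap ad lq lp _ ecq ecp Fcs esq; rewrite qc eq_sym pq => /(_ isT).
- by have := leaf_nonadj ad lp lq pq; rewrite epq.
Qed.

(** [cut_edge] says that each neighbour s of c has p or q on its side.  If p and
    q were on one side, then any other neighbour of c would contradict this. *)
Lemma cut_vertex_adjacent S F p q c :
  optimal S F -> leaf S F p -> leaf S F q -> p != q ->
  c \in S -> e c p -> e c q ->
  ~~ connect (delV F c) p q /\
  forall v, v \in S -> v != c -> connect (delV F c) v p || connect (delV F c) v q.
Proof.
move=> ad lp lq pq cS ecp ecq; have sg := opt_sg ad; have sF := sg_sym sg.
have ne x y : e x y -> x != y by apply: contraTneq => ->; rewrite e_irr.
have cut s := @cut_edge S F p q c s ad lp lq pq ecp ecq.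
have enter x : x \in S -> x != c -> exists s, F c s /\ connect (delV F c) x s.
  move=> xS xc; have [s [Fsc xs]] := connect_enter (sg_conn sg xS cS) xc.
  by exists s; rewrite sF.
have toc x s s' : connect (delV F c) x s' -> F c s' -> s != s' ->
    connect (delE F c s) x c.
  move=> xs' Fs' ss'; apply: connect_trans (connect_subrel (@delV_delE _ F c s) xs') _.
  apply: connect1; rewrite /delE /= sF Fs' !xpair_eqE eqxx /= andbT.
  rewrite [s' == s]eq_sym ss' andbT eq_sym.
  by rewrite (negPf (sg_neq e_irr sg Fs')).
have pc : p != c by rewrite eq_sym ne. have qc : q != c by rewrite eq_sym ne.
have [s1 [Fs1 ps1]] := enter _ (leaf_in lp) pc.
have [s2 [Fs2 qs2]] := enter _ (leaf_in lq) qc.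
split.
  apply/negP => pq'; have [|s [Fs ss1]] := @deg_ge2 _ F c s1.
    rewrite ltnNge; apply/negP => dc.
    by have := leaf_nonadj ad (Leaf cS dc) lp (ne _ _ ecp); rewrite ecp.
  have := cut s Fs; rewrite (toc p s s1) // (toc q s s1) //.
  by rewrite (sg_Vsym _ sg) in pq'; apply: connect_trans pq' ps1.
move=> v vS vc; have [s [Fs vs]] := enter _ vS vc.
have := cut s Fs; rewrite negb_and => /orP[pN|qN]; apply/orP; [left|right].
  have s1s : s = s1 by apply: contraNeq pN => ss1; apply: toc ps1 Fs1 ss1.
  by apply: connect_trans vs _; rewrite (sg_Vsym _ sg) s1s.
have s2s : s = s2 by apply: contraNeq qN => ss2; apply: toc qs2 Fs2 ss2.
by apply: connect_trans vs _; rewrite (sg_Vsym _ sg) s2s.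
Qed.

(** * Walks that leave the subgraph *)

(** The first vertex x of the walk is exempt from lying outside S: it is a leaf of
    the subgraph in question, and z may be x itself. *)
Definition reach S x z := connect [rel u v | e u v && (v \notin S)] x z.

(** The leaf x of F is prolonged, through vertices outside S, to the leaf z of
    F1; the fields record how the other leaves and the connectivity between old
    vertices are preserved. *)
Record prolonged S F x z S1 F1 : Prop := Prolonged {
  pr_opt : optimal S1 F1;
  pr_leaf : leaf S1 F1 z;
  pr_S : {subset S <= S1};
  pr_F : subrel F F1;
  pr_new : forall v, v \in S1 -> v \notin S -> reach S x v;
  pr_other : forall y, leaf S F y -> y != x -> leaf S1 F1 y;
  pr_conn : forall c u v, u \in S -> v \in S ->
    connect (delV F1 c) u v -> connect (delV F c) u v;
  pr_link : forall c d, c \in S -> d \in S -> c != x -> d != x ->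
    connect (delV (delV F1 c) d) x z;
  pr_z : z = x \/ z \notin S }.

Lemma prolonged_pendant S F x z : optimal S F -> leaf S F x -> z \notin S -> e x z ->
  prolonged S F x z (z |: S) (addE F x z).
Proof.
move=> ad [xS dx] zS exz; have sg := opt_sg ad.
have sg' := subgraph_pendant e_sym sg xS zS exz.
have xz : x != z by apply: contraNneq zS => <-.
have le y := deg_addE F y xz.
have dz : deg (addE F x z) z <= 1.
  apply: leq_trans (le z) _.
  by rewrite (deg_out sg zS) eqxx eq_sym (negPf xz).
split.
- split=> //.
    by move=> v; case: (opt_dom ad v) => [vS|[u uS euv]];
      [left|right; exists u => //]; rewrite inE ?vS ?uS orbT.
  apply: leq_trans (excess_le _) (opt_excess ad) => y; rewrite leq_max.
  have [->|yz] := eqVneq y z; first by rewrite (leq_trans dz).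
  have := le y; rewrite (negPf yz) addn0; have [->|_] := eqVneq y x => le_y.
    by rewrite (leq_trans le_y) // addn1 ltnS.
  by rewrite addn0 in le_y; rewrite le_y orbT.
- by split; rewrite // !inE eqxx.
- by move=> v vS; rewrite inE vS orbT.
- exact: sub_addE.
- move=> v; rewrite !inE => /orP[/eqP->|->] // _.
  by apply: connect1; rewrite /= exz.
- move=> y [yS dy] yx; split; first by rewrite inE yS orbT.
  have yz : y != z by apply: contraNneq zS => <-.
  by apply: leq_trans (le y) _; rewrite (negPf yx) (negPf yz) !addn0.
- move=> c u v uS vS uv.
  have ne w : w \in S -> w != z by apply: contraTneq => ->.
  apply: (@connect_subrel _ (delV (delV (addE F x z) c) z)).
    move=> a b /and3P[/and3P[/or3P[Fab|ab|ab] ac bc] az bz]; first exact/and3P.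
      by rewrite xpair_eqE (negPf bz) andbF in ab.
    by rewrite xpair_eqE (negPf az) in ab.
  apply: connect_delV_leaf; rewrite ?ne //.
    exact/delV_sym/(sg_sym sg').
  by apply: leq_trans dz; apply/deg_subrel/sub_delV.
- move=> c d cS dS cx dx'; apply/connect1/and3P; split.
  + apply/and3P; split; first by rewrite /addE /= eqxx orbT.
      by rewrite eq_sym.
    by apply: contraNneq zS => ->.
  + by rewrite eq_sym.
  + by apply: contraNneq zS => ->.
- by right.
Qed.

Lemma prolong S F x z : optimal S F -> leaf S F x -> reach S x z ->
  exists S1 F1, prolonged S F x z S1 F1.
Proof.
move=> ad lx /connectP[p0 p0P ->]; case: (shortenP p0P) => p pP up _ {p0 p0P z}.
elim: p S F x ad lx pP up => [|v p IHp] S F x ad lx /=.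
  move=> _ _; exists S, F; split=> //.
  - by move=> v ->.
  - by left.
case/andP=> /andP[exv vS] pP /andP[xp up].
have [ad' lv S' F' new' other' conn' link' _] := prolonged_pendant ad lx vS exv.
have pP' : path [rel a b | e a b && (b \notin v |: S)] v p.
  case/andP: up => vp _.
  elim: p {1 4}v pP vp {IHp xp} => //= w p IHp a.
  move=> /andP[/andP[eaw wS] pP]; rewrite inE negb_or => /andP[vw vp].
  by rewrite IHp // !inE negb_or eaw eq_sym vw wS.
have [S1 [F1 []]] := IHp _ _ _ ad' lv pP' up; set z := last v p.
move=> ad1 lz S1sub F1sub new1 other1 conn1 link1 z1.
exists S1, F1; split=> //.
- by move=> w /S' /S1sub.
- by move=> a b /F' /F1sub.
- move=> w wS1 wS; have [/new'|wS'] := boolP (w \in v |: S); first exact.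
  have xv : reach S x v by apply: connect1; rewrite /= exv.
  apply: connect_trans xv _; apply: connect_subrel (new1 w wS1 wS') => a b /=.
  by rewrite inE negb_or => /andP[-> /andP[]].
- move=> y ly yx; apply: other1; first exact: other'.
  by apply: contraNneq vS => <-; case: ly.
- move=> c u w uS wS uw; apply: conn' => //; apply: conn1 => //; exact: S'.
- move=> c d cS dS cx dx.
  have nv w : w \in S -> w != v by apply: contraTneq => ->.
  apply: connect_trans (link1 c d _ _ _ _); rewrite ?S' ?nv //.
  apply: connect_subrel (link' c d cS dS cx dx).
  by do 2!apply: delV_subrel.
- right; case: z1 => [->//|]; apply: contra; exact: S'.
Qed.

(** Prolong x to z and apply [leaf_nonadj] there. *)
Lemma reach_nonadj_leaf S F x y z :
  optimal S F -> leaf S F x -> leaf S F y -> x != y ->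
  reach S x z -> ~~ e z y.
Proof.
move=> ad lx ly xy xz; have [S1 [F1 pr]] := prolong ad lx xz.
have [->|yz] := eqVneq z y; first by rewrite e_irr.
apply: (leaf_nonadj (pr_opt pr)) => //.
  exact: pr_leaf pr.
by apply: (pr_other pr) => //; rewrite eq_sym.
Qed.

(** The walk from y is shifted vertex by vertex to the end of the walk from x,
    until y itself is reached. *)
Lemma reach_nonadj S F x y z w : optimal S F -> leaf S F x -> leaf S F y -> x != y ->
  reach S x z -> reach S y w -> ~~ e z w.
Proof.
move=> ad lx ly xy xz yw; apply/negP; elim/connect_indr: yw z xz => [|w0 w1 _ IH].
  by move=> z xz ezy; have := reach_nonadj_leaf ad lx ly xy xz; rewrite ezy.
move=> /andP[ew w1S] z xz ezw; apply: (IH w1); last by rewrite e_sym.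
by apply: connect_trans xz (connect1 _); apply/andP.
Qed.

Lemma reach_disjoint S F x y z : optimal S F -> leaf S F x -> leaf S F y -> x != y ->
  reach S x z -> ~~ reach S y z.
Proof.
move=> ad lx ly xy xz; apply/negP => yz.
have [zy|zy] := eqVneq z y.
  move: xz; rewrite zy => /connectP[p]; elim/last_ind: p => [|p t _].
    by move=> _ /= yx; rewrite yx eqxx in xy.
  rewrite rcons_path last_rcons => /andP[_ /andP[_ tS]] yt.
  by rewrite -yt (leaf_in ly) in tS.
have [|w [/andP[ewz zS] yw]] := connect_enter yz; first by rewrite eq_sym.
have := reach_nonadj ad lx ly xy xz (connect_subrel (@sub_delV _ _ z) yw).
by rewrite e_sym ewz.
Qed.

(** Here c is unrestricted; the case of interest is that c lies in S. *)
Definition attached S x c := exists2 z, reach S x z & e z c.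

Lemma attached_not_leaf S F x y : optimal S F -> leaf S F x -> leaf S F y -> x != y ->
  ~ attached S x y.
Proof.
move=> ad lx ly xy [z xz ezy].
by have := reach_nonadj_leaf ad lx ly xy xz; rewrite ezy.
Qed.

Lemma attached_neq S F x y c : optimal S F -> leaf S F x -> leaf S F y -> x != y ->
  attached S x c -> attached S y c -> c != x.
Proof.
move=> ad lx ly xy _ yc; apply/eqP => cx; rewrite cx in yc.
by apply: (attached_not_leaf ad ly lx) yc; rewrite eq_sym.
Qed.

(** The walk from y to c cannot meet the vertices used to prolong x, because
    walks outside S from distinct leaves are disjoint. *)
Lemma prolonged_attached S F x z S1 F1 y c :
  optimal S F -> leaf S F x -> leaf S F y ->
  y != x -> prolonged S F x z S1 F1 -> attached S y c -> attached S1 y c.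
Proof.
move=> ad lx ly yx pr [w yw ewc]; exists w => //.
elim/connect_indr: yw => [|a b ya ya1 /andP[eab bS]]; first exact: connect0.
have yb : reach S y b by apply: connect_trans ya (connect1 _); apply/andP.
apply: connect_trans ya1 (connect1 _); apply/andP; split=> //.
apply/negP => bS1; have := reach_disjoint ad ly lx yx yb.
by rewrite (pr_new pr).
Qed.

(** Prolonging both leaves until they are adjacent to c reduces this to
    [cut_vertex_adjacent]. *)
Lemma cut_vertex S F x y c : optimal S F -> leaf S F x -> leaf S F y -> x != y ->
  c \in S -> attached S x c -> attached S y c ->
  ~~ connect (delV F c) x y /\
  forall v, v \in S -> v != c -> connect (delV F c) v x || connect (delV F c) v y.
Proof.
move=> ad lx ly xy cS xc yc; have yx : y != x by rewrite eq_sym.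
have cx := attached_neq ad lx ly xy xc yc; have cy := attached_neq ad ly lx yx yc xc.
case: xc => z xz ezc.
have [S1 [F1 pr1]] := prolong ad lx xz.
have [w yw ewc] := prolonged_attached ad lx ly yx pr1 yc.
have ad1 := pr_opt pr1; have ly1 := pr_other pr1 ly yx.
have [S2 [F2 pr2]] := prolong ad1 ly1 yw.
have ad2 := pr_opt pr2; have lw := pr_leaf pr2.
have zy : z != y.
  case: (pr_z pr1) => [->//|zS]; apply: contraNneq zS => ->; exact: leaf_in ly.
have lz := pr_other pr2 (pr_leaf pr1) zy.
have sub1 := pr_S pr1; have sub2 := pr_S pr2.
have cS1 := sub1 _ cS; have cS2 := sub2 _ cS1.
have zw : z != w.
  case: (pr_z pr2) => [->//|wS]; apply: contraNneq wS => <-.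
  exact: leaf_in (pr_leaf pr1).
have ecz : e c z by rewrite e_sym. have ecw : e c w by rewrite e_sym.
have [sep side] := cut_vertex_adjacent ad2 lz lw zw cS2 ecz ecw.
have sym2 := sg_Vsym c (opt_sg ad2).
have linkx : connect (delV F2 c) x z.
  apply: connect_subrel (pr_link pr1 cS cS cx cx).
  move=> a b /sub_delV; apply: delV_subrel; exact: pr_F pr2.
have linky : connect (delV F2 c) y w.
  by apply: connect_subrel (pr_link pr2 cS1 cS1 cy cy); apply: sub_delV.
have sub : subrel (delV F c) (delV F2 c).
  by apply: delV_subrel => a b /(pr_F pr1)/(pr_F pr2).
have back a b : a \in S -> b \in S -> connect (delV F2 c) a b ->
    connect (delV F c) a b.
  by move=> aS bS ab; apply: (pr_conn pr1) => //; apply: (pr_conn pr2) => //;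
    apply: sub1.
have xS := leaf_in lx; have yS := leaf_in ly.
split.
  apply: contra sep => xy'; rewrite sym2 in linkx.
  exact: connect_trans linkx (connect_trans (connect_subrel sub xy') linky).
move=> v vS vc; have [vz|vw] := orP (side v (sub2 _ (sub1 _ vS)) vc); apply/orP.
  by left; apply: back => //; apply: connect_trans vz _; rewrite sym2.
by right; apply: back => //; apply: connect_trans vw _; rewrite sym2.
Qed.

(** The last vertices of three such connections would be the ends of a claw
    with centre c. *)
Lemma three_not_attached S F x y t c :
  optimal S F -> leaf S F x -> leaf S F y -> leaf S F t ->
  x != y -> x != t -> y != t -> c \in S ->
  attached S x c -> attached S y c -> attached S t c -> False.
Proof.
move=> ad lx ly lt xy xt yt cS xc yc tc.
case: xc => z xz ezc.
have [S1 [F1 pr1]] := prolong ad lx xz.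
have yx : y != x by rewrite eq_sym. have tx : t != x by rewrite eq_sym.
have ty : t != y by rewrite eq_sym.
have tc1 := prolonged_attached ad lx lt tx pr1 tc.
have ly1 := pr_other pr1 ly yx; have lt1 := pr_other pr1 lt tx.
have ad1 := pr_opt pr1.
have [w yw ewc] := prolonged_attached ad lx ly yx pr1 yc.
have [S2 [F2 pr2]] := prolong ad1 ly1 yw.
have [u tu euc] := prolonged_attached ad1 ly1 lt1 ty pr2 tc1.
have ad2 := pr_opt pr2; have lt2 := pr_other pr2 lt1 ty.
have [S3 [F3 pr3]] := prolong ad2 lt2 tu.
have zne v : leaf S F v -> v != x -> z != v.
  move=> lv vx; case: (pr_z pr1) => [->|zS]; first by rewrite eq_sym.
  by apply: contraNneq zS => ->; exact: leaf_in lv.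
have wt : w != t.
  case: (pr_z pr2) => [->//|wS]; apply: contraNneq wS => ->; exact: leaf_in lt1.
have lz2 := pr_other pr2 (pr_leaf pr1) (zne _ ly yx).
have lz3 := pr_other pr3 lz2 (zne _ lt tx).
have lw3 := pr_other pr3 (pr_leaf pr2) wt.
have lu3 := pr_leaf pr3; have ad3 := pr_opt pr3.
have zw : z != w.
  case: (pr_z pr2) => [->|wS]; first exact: zne.
  by apply: contraNneq wS => <-; exact: leaf_in (pr_leaf pr1).
have ne_u v : v \in S2 -> v != t -> v != u.
  by move=> vS vt; case: (pr_z pr3) => [->//|uS]; apply: contraNneq uS => <-.
have zu := ne_u _ (leaf_in lz2) (zne _ lt tx).
have wu := ne_u _ (leaf_in (pr_leaf pr2)) wt.
rewrite e_sym in ezc; rewrite e_sym in ewc; rewrite e_sym in euc.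
have [ezw|ezu|ewu] := clawP e_sym e_irr claw ezc ewc euc zw zu wu.
- by have := leaf_nonadj ad3 lz3 lw3 zw; rewrite ezw.
- by have := leaf_nonadj ad3 lz3 lu3 zu; rewrite ezu.
- by have := leaf_nonadj ad3 lw3 lu3 wu; rewrite ewu.
Qed.

(** * The cut vertices of different pairs of leaves *)

(** Suppose that c' is not on the side of i and l at c, hence on the side of j.
    Let s be the neighbour of c' towards l, and exchange the edge sc' for the
    connection from l to c' outside S.  Then i is joined to l, from there to c',
    and on to j, all this without c, although c must still separate i from j in
    the new subgraph. *)
Lemma cut_vertex_same_side S F i j l c c' : optimal S F ->
  leaf S F i -> leaf S F j -> leaf S F l ->
  i != j -> l != j -> i != l -> c \in S -> c' \in S -> c != c' ->
  attached S i c -> attached S j c -> attached S l c' -> attached S j c' ->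
  connect (delV F c) i l -> connect (delV F c') i l ->
  connect (delV F c) c' i.
Proof.
move=> ad li lj ll ij lj' il cS c'S cc' ic jc lc jc' il_c il_c'.
apply: contraT => c'i; have sg := opt_sg ad; have sF := sg_sym sg.
have symV d := sg_Vsym d sg.
have ji : j != i by rewrite eq_sym. have jl : j != l by rewrite eq_sym.
have c'c : c' != c by rewrite eq_sym.
have [ij_c side_c] := cut_vertex ad li lj ij cS ic jc.
have [lj_c' _] := cut_vertex ad ll lj lj' c'S lc jc'.
have c'j : connect (delV F c) c' j.
  by have := side_c _ c'S c'c; rewrite (negPf c'i).
have lc' : l != c' by rewrite eq_sym (attached_neq ad ll lj lj' lc jc').
have cl : c != l.
  by apply/eqP => cl; rewrite cl in ic; apply: (attached_not_leaf ad li ll il) ic.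
have c'l : c' != l by rewrite eq_sym.
have [s [Fsc' ls]] := connect_enter (sg_conn sg (leaf_in ll) c'S) lc'.
have [z lz ezc'] := lc; have [S1 [F1 pr]] := prolong ad ll lz.
have ad1 := pr_opt pr; have sg1 := opt_sg ad1.
have zs : connect (delE F1 s c') z s.
  apply: connect_subrel (@delV_delEr _ F1 s c') _.
  rewrite (sg_Vsym _ sg1); apply: (@connect_trans _ _ l).
    rewrite (sg_Vsym _ sg1).
    by apply: connect_subrel ls; apply: delV_subrel; apply: pr_F pr.
  by apply: connect_subrel (pr_link pr c'S c'S c'l c'l); apply: sub_delV.
have [ad2 deg2] := optimal_swap ad1 (pr_leaf pr) (pr_F pr Fsc') ezc' zs.
set F2 := addE _ _ _ in ad2 deg2.
have leaf2 x : leaf S F x -> x != l -> leaf S1 F2 x.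
  move=> lx xl; have lx1 := pr_other pr lx xl; split; first exact: leaf_in lx1.
  apply: leq_trans (deg2 _ _) (leaf_deg lx1).
  case: (pr_z pr) => [->//|]; apply: contraNneq => <-; exact: leaf_in lx.
have cS1 := pr_S pr cS.
have ic1 := prolonged_attached ad ll li il pr ic.
have jc1 := prolonged_attached ad ll lj jl pr jc.
have [/negP ijN _] := cut_vertex ad2 (leaf2 _ li il) (leaf2 _ lj jl) ij cS1 ic1 jc1.
case: ijN.
have sub1 : subrel (delE F1 s c') F2 := @sub_addE _ _ z c'.
apply: (@connect_trans _ _ l).
  apply: (@connect_subrel _ (delV (delV F c) c')).
    move=> a b /and3P[/and3P[Fab ac bc] ac' bc']; apply/and3P; split=> //.
    apply: sub1; apply: (@delV_delEr _ F1 s c').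
    by apply/and3P; split=> //; apply: pr_F pr _ _ Fab.
  apply: connect_avoid il_c _; apply: contra c'i => ic'.
  by rewrite symV.
apply: (@connect_trans _ _ z).
  apply: connect_subrel (pr_link pr cS c'S cl c'l) => a b.
  case/and3P=> /and3P[Fab ac bc] ac' bc'.
  apply/and3P; split=> //; apply: sub1; apply: (@delV_delEr _ F1 s c').
  exact/and3P.
apply: (@connect_trans _ _ c').
  apply/connect1/and3P; split=> //.
    by rewrite /F2 /addE /= eqxx orbT.
  case: (pr_z pr) => [->|zS]; first by rewrite eq_sym.
  by apply: contraNneq zS => ->.
apply: (@connect_subrel _ (delE (delV F c) c' s)).
  move=> a b /and3P[/and3P[Fab ac bc] ab1 ab2]; apply/and3P; split=> //.
  by apply: sub1; apply/and3P; split=> //; apply: pr_F pr _ _ Fab.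
have symD : connect_sym (delE (delV F c) c' s).
  exact/sym_connect_sym/delE_sym/delV_sym.
rewrite symD; have jc'_c : connect (delV F c) j c' by rewrite symV.
have [//|js] := connect_delE_dicho s jc'_c; apply: contraT => jNc'.
case/negP: lj_c'; apply: connect_trans ls _; rewrite symV.
apply: connect_subrel (connect_avoid js jNc'); apply: delV_subrel.
by move=> a b /sub_delE/sub_delV.
Qed.

(** By [cut_vertex_same_side], c' lies on the side of i at c, and c on the side of
    l at c'.  But a walk from j to c meets c or c' first, which puts c on the side
    of j at c', or c' on the side of j at c. *)
Lemma links_not_parallel S F i j l c c' : optimal S F ->
  leaf S F i -> leaf S F j -> leaf S F l ->
  i != j -> l != j -> i != l -> c \in S -> c' \in S ->
  attached S i c -> attached S j c -> attached S l c' -> attached S j c' ->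
  connect (delV F c) i l -> connect (delV F c') i l -> False.
Proof.
move=> ad li lj ll ij lj' il cS c'S ic jc lc jc' il_c il_c'.
have sg := opt_sg ad; have symV d := sg_Vsym d sg.
have jl : j != l by rewrite eq_sym.
have [/negP ij_c _] := cut_vertex ad li lj ij cS ic jc.
have [/negP lj_c' _] := cut_vertex ad ll lj lj' c'S lc jc'.
have cc' : c != c'.
  apply/eqP => cc'; rewrite -cc' in lc.
  exact: (three_not_attached ad li lj ll) ic jc lc.
have c'i : connect (delV F c) c' i.
  exact: (cut_vertex_same_side ad li lj ll) ic jc lc jc' il_c il_c'.
have cl : connect (delV F c') c l.
  by apply: (cut_vertex_same_side ad ll lj li) lc jc' ic jc _ _ => //;
    rewrite 1?eq_sym // symV.
have [jc_c'|jc'_c] := connect_first cc' (sg_conn sg (leaf_in lj) cS).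
  by apply: lj_c'; rewrite symV; apply: connect_trans jc_c' cl.
by apply: ij_c; rewrite symV; apply: connect_trans jc'_c c'i.
Qed.

(** For vertices x, y of S this is what a walk of length four between their
    private neighbours provides, c being its middle vertex. *)
Definition link S x y c := [/\ c \in S, attached S x c & attached S y c].

Section SixPairs.
Variables (S : {set V}) (F : rel V).
Hypothesis ad : optimal S F.
Local Notation R c := (connect (delV F c)).
Local Notation link := (link S).

Let Rsym c : symmetric (R c).
Proof. exact: sg_Vsym c (opt_sg ad). Qed.

Let Rtrans c x y z : R c x y -> R c y z -> R c x z.
Proof. exact: connect_trans. Qed.

(** When F is a tree, a cut vertex of pq or pr that leaves q and r together lies
    between p and the path from q to r; there is room for only one of them. *)
Lemma no_common_leg p q r c c' : leaf S F p -> leaf S F q -> leaf S F r ->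
  p != q -> p != r -> q != r -> link p q c -> link p r c' ->
  R c q r -> ~~ R c' q r.
Proof.
move=> lp lq lr pq pr qr [cS pc qc] [c'S pc' rc'] qr_c; apply/negP => qr_c'.
rewrite eq_sym in pq; rewrite eq_sym in pr.
exact: (links_not_parallel ad lq lp lr pq pr qr cS c'S qc pc rc' pc').
Qed.

Lemma link_split p q r c : leaf S F p -> leaf S F q -> leaf S F r ->
  p != q -> r != p -> r != q -> link p q c -> ~~ R c p q /\ (R c r p || R c r q).
Proof.
move=> lp lq lr pq rp rq [cS pc qc].
have [sep side] := cut_vertex ad lp lq pq cS pc qc; split=> //.
apply: side; first exact: leaf_in lr.
apply/eqP => rc; rewrite -rc in pc; rewrite eq_sym in rp.
exact: (attached_not_leaf ad lp lr rp pc).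
Qed.

(** Both walks have to pass through b. *)
Lemma cross b c x y x' y' : ~~ R b x y -> ~~ R b x' y' ->
  R c x y -> R c x' y' -> R c x x'.
Proof.
have tob u v : ~~ R b u v -> R c u v -> R c u b.
  move=> uv_b uv_c; apply: contraT => ub; case/negP: uv_b.
  apply: connect_subrel (connect_avoid uv_c ub); apply: delV_subrel.
  exact: sub_delV.
by move=> nxy nx'y' /(tob _ _ nxy) xb /(tob _ _ nx'y'); rewrite Rsym; apply: Rtrans.
Qed.

Record all_linked b x1 x2 x3 x4 : Prop := Linked {
  lk_uniq : uniq [:: x1; x2; x3; x4];
  lk_leaf : forall x, x \in [:: x1; x2; x3; x4] -> leaf S F x;
  lk_sep : forall x y, x \in [:: x1; x2] -> y \in [:: x3; x4] -> ~~ R b x y;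
  lk_link : forall x y, x \in [:: x1; x2; x3; x4] -> y \in [:: x1; x2; x3; x4] ->
    x != y -> exists c, link x y c }.

Lemma all_linked_swap12 b x1 x2 x3 x4 :
  all_linked b x1 x2 x3 x4 -> all_linked b x2 x1 x3 x4.
Proof.
have perm12 : perm_eq [:: x1; x2; x3; x4] [:: x2; x1; x3; x4].
  exact/permPl/(perm_catCA [:: x1] [:: x2] [:: x3; x4]).
case=> u l s lk; split.
- by rewrite -(perm_uniq perm12).
- by move=> x; rewrite -(perm_mem perm12); apply: l.
- by move=> x y; rewrite !inE orbC => xi yi; apply: s; rewrite !inE.
- by move=> x y; rewrite -!(perm_mem perm12); apply: lk.
Qed.

Lemma all_linked_swap b x1 x2 x3 x4 :
  all_linked b x1 x2 x3 x4 -> all_linked b x3 x4 x1 x2.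
Proof.
have perm : perm_eq [:: x1; x2; x3; x4] [:: x3; x4; x1; x2].
  exact/permPl/(perm_catC [:: x1; x2] [:: x3; x4]).
case=> u l s lk; split.
- by rewrite -(perm_uniq perm).
- by move=> x; rewrite -(perm_mem perm); apply: l.
- by move=> x y xi yi; rewrite Rsym; apply: s.
- by move=> x y; rewrite -!(perm_mem perm); apply: lk.
Qed.

(** When F is a tree, its subtree spanned by the four leaves consists of four legs
    and a middle segment containing b.  If c12 lies in the leg of x1 and c34 in the
    leg of x3, then [no_common_leg] puts c13 into the middle segment, hence c14 into
    the leg of x4 and c23 into the leg of x2, and it leaves no place for c24. *)
Lemma all_linked_legs b x1 x2 x3 x4 c12 c34 : all_linked b x1 x2 x3 x4 ->
  link x1 x2 c12 -> link x3 x4 c34 ->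
  R c12 x3 x2 -> R c12 x4 x2 -> R c34 x1 x4 -> R c34 x2 x4 -> False.
Proof.
move=> L k12 k34 r12_3 r12_4 r34_1 r34_2.
have [l1 l2 l3 l4] : [/\ leaf S F x1, leaf S F x2, leaf S F x3 & leaf S F x4].
  by split; apply: lk_leaf L _ _; rewrite !inE eqxx ?orbT.
have := lk_uniq L; rewrite /= !inE !negb_or.
case/and4P=> /and3P[n12 n13 n14] /andP[n23 n24] n34 _.
have n21 : x2 != x1 by rewrite eq_sym. have n31 : x3 != x1 by rewrite eq_sym.
have n41 : x4 != x1 by rewrite eq_sym. have n32 : x3 != x2 by rewrite eq_sym.
have n42 : x4 != x2 by rewrite eq_sym. have n43 : x4 != x3 by rewrite eq_sym.
have sep := lk_sep L.
have s13 : ~~ R b x1 x3 by apply: sep; rewrite !inE eqxx ?orbT.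
have s14 : ~~ R b x1 x4 by apply: sep; rewrite !inE eqxx ?orbT.
have s23 : ~~ R b x2 x3 by apply: sep; rewrite !inE eqxx ?orbT.
have s24 : ~~ R b x2 x4 by apply: sep; rewrite !inE eqxx ?orbT.
have lk x y : x != y -> x \in [:: x1; x2; x3; x4] -> y \in [:: x1; x2; x3; x4] ->
  exists c, link x y c by move=> *; apply: (lk_link L).
have [|| c13 k13] := lk x1 x3 n13; rewrite ?inE ?eqxx ?orbT //.
have [|| c14 k14] := lk x1 x4 n14; rewrite ?inE ?eqxx ?orbT //.
have [|| c23 k23] := lk x2 x3 n23; rewrite ?inE ?eqxx ?orbT //.
have [|| c24 k24] := lk x2 x4 n24; rewrite ?inE ?eqxx ?orbT //.
have flip x y c : link x y c -> link y x c by case=> ? ? ?; split.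
(* c13 joins x1 to x2 and x3 to x4: the middle segment. *)
have [c13_sep c13_2] := link_split l1 l3 l2 n13 n21 n23 k13.
have [_ c13_4] := link_split l1 l3 l4 n13 n41 n43 k13.
have c13_23 : ~~ R c13 x2 x3.
  by apply: (no_common_leg l1 l2 l3 n12 n13 n23 k12 k13); rewrite Rsym.
rewrite (negPf c13_23) orbF in c13_2.
have c13_41 : ~~ R c13 x4 x1.
  by apply: (no_common_leg l3 l4 l1 n34 n31 n41 k34 (flip _ _ _ k13)); rewrite Rsym.
rewrite (negPf c13_41) /= in c13_4.
(* c14 joins x1, x2 and x3: the leg of x4. *)
have [c14_sep c14_2] := link_split l1 l4 l2 n14 n21 n24 k14.
have [_ c14_3] := link_split l1 l4 l3 n14 n31 n34 k14.
have c14_24 : ~~ R c14 x2 x4.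
  by apply: (no_common_leg l1 l2 l4 n12 n14 n24 k12 k14); rewrite Rsym.
rewrite (negPf c14_24) orbF in c14_2.
have c14_34 : ~~ R c14 x3 x4.
  by apply: (no_common_leg l1 l3 l4 n13 n14 n34 k13 k14); rewrite Rsym.
rewrite (negPf c14_34) orbF in c14_3.
(* c23 joins x1, x3 and x4: the leg of x2. *)
have [c23_sep c23_1] := link_split l2 l3 l1 n23 n12 n13 k23.
have [_ c23_4] := link_split l2 l3 l4 n23 n42 n43 k23.
have c23_12 : ~~ R c23 x1 x2.
  apply: (no_common_leg l3 l1 l2 n31 n32 n12 (flip _ _ _ k13) (flip _ _ _ k23)).
  by rewrite Rsym.
rewrite (negPf c23_12) /= in c23_1.
have c23_42 : ~~ R c23 x4 x2.
  by apply: (no_common_leg l3 l4 l2 n34 n32 n42 k34 (flip _ _ _ k23)); rewrite Rsym.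
rewrite (negPf c23_42) /= in c23_4.
(* c24 can only join x1 to x4 and x2 to x3, which [cross] forbids. *)
have [c24_sep c24_1] := link_split l2 l4 l1 n24 n12 n14 k24.
have [_ c24_3] := link_split l2 l4 l3 n24 n32 n34 k24.
have c24_12 : ~~ R c24 x1 x2.
  apply: (no_common_leg l4 l1 l2 n41 n42 n12 (flip _ _ _ k14) (flip _ _ _ k24)).
  by rewrite Rsym.
have c24_34 : ~~ R c24 x3 x4.
  by apply: (no_common_leg l2 l3 l4 n23 n24 n34 k23 k24); rewrite Rsym.
rewrite (negPf c24_12) /= in c24_1; rewrite (negPf c24_34) orbF in c24_3.
case/negP: c24_sep; rewrite Rsym in c24_3.
rewrite Rsym; apply: Rtrans (_ : R c24 x1 x2); first by rewrite Rsym.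
by apply: (cross s14 s23).
Qed.

(** If c separated both x1 from x2 and x3 from x4, then a walk joining x1 to x3
    or x4 and one joining x2 to the other would both pass through b, and x1 would be
    joined to x2. *)
Lemma all_linked_same_side b x1 x2 x3 x4 c : all_linked b x1 x2 x3 x4 ->
  link x1 x2 c -> (R c x3 x1 && R c x4 x1) || (R c x3 x2 && R c x4 x2).
Proof.
move=> L k12.
have [l1 l2 l3 l4] : [/\ leaf S F x1, leaf S F x2, leaf S F x3 & leaf S F x4].
  by split; apply: lk_leaf L _ _; rewrite !inE eqxx ?orbT.
have := lk_uniq L; rewrite /= !inE !negb_or.
case/and4P=> /and3P[n12 n13 n14] /andP[n23 n24] n34 _.
have n31 : x3 != x1 by rewrite eq_sym. have n41 : x4 != x1 by rewrite eq_sym.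
have n32 : x3 != x2 by rewrite eq_sym. have n42 : x4 != x2 by rewrite eq_sym.
have [sep s3] := link_split l1 l2 l3 n12 n31 n32 k12.
have [_ s4] := link_split l1 l2 l4 n12 n41 n42 k12.
have sepb := lk_sep L.
case/orP: s3 => s3; case/orP: s4 => s4; rewrite ?s3 ?s4 ?orbT //.
  case/negP: sep; apply: (@cross b c x1 x3 x2 x4); rewrite 1?Rsym //;
  by rewrite Rsym; apply: sepb; rewrite !inE eqxx ?orbT.
case/negP: sep; apply: (@cross b c x1 x4 x2 x3); rewrite 1?Rsym //;
by rewrite Rsym; apply: sepb; rewrite !inE eqxx ?orbT.
Qed.

Lemma not_all_linked b x1 x2 x3 x4 : ~ all_linked b x1 x2 x3 x4.
Proof.
move=> L.
have wlog12 : exists y1 y2 c, [/\ all_linked b y1 y2 x3 x4, link y1 y2 c,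
    R c x3 y2 & R c x4 y2].
  have [|||c k12] := lk_link L (x := x1) (y := x2); rewrite ?inE ?eqxx ?orbT //.
    by case/andP: (lk_uniq L); rewrite !inE negb_or => /andP[].
  case/orP: (all_linked_same_side L k12) => /andP[r3 r4].
    exists x2, x1, c; split=> //; first exact: all_linked_swap12.
    by case: k12.
  by exists x1, x2, c.
case: wlog12 => {L x1 x2} x1 [x2 [c12 [L k12 r3 r4]]].
have L' := all_linked_swap L.
have [|||c34 k34] := lk_link L (x := x3) (y := x4); rewrite ?inE ?eqxx ?orbT //.
  by case/and4P: (lk_uniq L) => _ _; rewrite inE.
case/orP: (all_linked_same_side L' k34) => /andP[r1 r2]; last first.
  exact: (all_linked_legs L k12 k34).
have k43 : link x4 x3 c34 by case: k34.
exact: (all_linked_legs (all_linked_swap (all_linked_swap12 L')) k12 k43).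
Qed.

End SixPairs.

(** * Private neighbours and the degree sums *)

Definition private S x y :=
  [/\ y \notin S, e x y & forall u, u \in S -> e u y -> u = x].

(** Otherwise x could be deleted from S. *)
Lemma private_neighbour S F x : optimal S F ->
  (forall S' F', optimal S' F' -> darts F <= darts F') -> leaf S F x ->
  exists y, private S x y.
Proof.
move=> ad min [xS dx]; apply: NNPP => none.
have sg := opt_sg ad; have sF := sg_sym sg.
have [u u3] : exists u, 2 < deg F u.
  by apply: excess_gt0; apply: leq_trans k_gt0 (k_min sg (opt_dom ad)).
have uS : u \in S by apply: contraTT u3 => /(deg_out sg) ->.
have ux : u != x by apply: contraTneq u3 => ->; rewrite -leqNgt ltnW // ltnS.
have [w [Fwx _]] := connect_enter (sg_conn sg uS xS) ux.
have wx : w != x := sg_neq e_irr sg Fwx.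
have sub := @sub_delV _ F x.
have ad' : optimal (S :\ x) (delV F x).
  split.
  - split; first exact: delV_sym.
    + by move=> a b /sub/(sg_sub sg).
    + by move=> a b /and3P[/(sg_in sg) aS ax _]; rewrite !inE ax.
    move=> a b; rewrite !inE => /andP[ax aS] /andP[bx bS].
    by apply: connect_delV_leaf => //; apply: sg_conn sg _ _ aS bS.
  - move=> v; rewrite !inE; have [->|vx] /= := eqVneq v x.
      by right; exists w; rewrite ?inE ?wx ?(sg_in sg Fwx) ?(sg_sub sg Fwx).
    case: (opt_dom ad v) => [|[t tS etv]]; first by left.
    have [tx|tx] := eqVneq t x; last by right; exists t; rewrite // !inE tx.
    have [vS|vS] := boolP (v \in S); first by left.
    right; apply: NNPP => no; apply: none; exists v; split; rewrite // -?tx //.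
    move=> a aS eav; apply/eqP; rewrite tx; apply/negPn/negP => ax; apply: no.
    by exists a; rewrite // !inE ax.
  apply: leq_trans (excess_le _) (opt_excess ad) => v.
  by rewrite leq_max (deg_subrel v sub) orbT.
have := min _ _ ad'; rewrite leqNgt (darts_lt sub (x := x)) //.
rewrite (_ : deg (delV F x) x = 0); last first.
  apply/eqP; rewrite cards_eq0; apply/eqP/setP=> v.
  by rewrite !inE /delV /= eqxx andbF.
by rewrite sF in Fwx; apply: deg_gt0 Fwx.
Qed.

Section PrivateNeighbours.
Variables (S : {set V}) (F : rel V).
Hypothesis ad : optimal S F.
Local Notation private := (private S).

Lemma private_reach x y : private x y -> reach S x y.
Proof. by case=> yS exy _; apply: connect1; rewrite /= exy. Qed.

Lemma private_reach_nbr x y z : private x y -> e y z -> reach S x z.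
Proof.
move=> pxy eyz; have [zS|zS] := boolP (z \in S).
  have -> : z = x by case: pxy => _ _; apply; rewrite // e_sym.
  exact: connect0.
by apply: connect_trans (private_reach pxy) (connect1 _); rewrite /= eyz.
Qed.

(** The closed neighbourhoods of y and y' are reached from x and x'.  Vertices
    reached from distinct leaves are distinct and not adjacent, which excludes
    length at most three and, for length four, a middle vertex outside S. *)
Lemma walk_link x y x' y' n : leaf S F x -> leaf S F x' -> x != x' ->
  private x y -> private x' y' -> has_walk e n y y' ->
  3 < n /\ (n < 5 -> exists c, link S x x' c).
Proof.
move=> lx lx' xx' pxy pxy' /existsP[[p /= /eqP <-] /andP[yp /eqP def_y']].
have na z z' := @reach_nonadj S F x x' z z' ad lx lx' xx'.
have dj z := @reach_disjoint S F x x' z ad lx lx' xx'.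
have ry := private_reach pxy; have ry' := private_reach pxy'.
have rn z := @private_reach_nbr x y z pxy.
have rn' z (e_z : e z y') : reach S x' z.
  by apply: private_reach_nbr pxy' _; rewrite e_sym.
case: p yp def_y' => [|z p] /= yp def_y'.
  by have := dj y ry; rewrite def_y' ry'.
case/andP: yp => eyz; case: p def_y' => [|t p] /= def_y' zp.
  by have := na _ _ ry ry'; rewrite -def_y' eyz.
case/andP: zp => ezt; case: p def_y' => [|u p] /= def_y' tp.
  by rewrite def_y' in ezt; have := dj z (rn z eyz); rewrite (rn' z).
case/andP: tp => etu; case: p def_y' => [|w p] /= def_y' up.
  rewrite def_y' in etu; have := na _ _ (rn z eyz) (rn' t etu); by rewrite ezt.
case/andP: up => euw; case: p def_y' => [|w' p] /= def_y' wp //.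
rewrite def_y' in euw; split=> // _; exists t.
have rz := rn z eyz; have ru := rn' u euw.
have [tS|tS] := boolP (t \in S); last first.
  have rt : reach S x t by apply: connect_trans rz (connect1 _); rewrite /= ezt.
  by have := na _ _ rt ru; rewrite etu.
by split=> //; [exists z | exists u; rewrite // e_sym].
Qed.

(** The closed neighbourhoods of the private neighbours consist of vertices
    reached from distinct leaves, so they are disjoint, and they meet S in the
    leaves only. *)
Lemma closed_nbhds_count (X : {set V}) (y : V -> V) :
  (forall x, x \in X -> leaf S F x /\ private x (y x)) ->
  #|S :\: X| + \sum_(x in X) (deg e (y x)).+1 <= #|V|.
Proof.
move=> X_in; pose B x := y x |: [set z | e (y x) z].
have cardB x : #|B x| = (deg e (y x)).+1 by rewrite cardsU1 inE e_irr.
have reachB x z : x \in X -> z \in B x -> reach S x z.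
  move=> xX; have [lx px] := X_in _ xX; rewrite !inE => /orP[/eqP->|].
    exact: private_reach.
  exact: private_reach_nbr.
have -> : \sum_(x in X) (deg e (y x)).+1 =
    \sum_(z : V) \sum_(x in X) (z \in B x : nat).
  rewrite exchange_big; apply: eq_bigr => x _; rewrite -cardB -sum1_card big_mkcond.
  by apply: eq_bigr => z _; case: (z \in B x).
rewrite -sum1_card big_mkcond /= -big_split /= -[X in _ <= X]sum1_card.
apply: leq_sum => z _.
have [/existsP[x /andP[xX zB]]|none] := boolP [exists x, (x \in X) && (z \in B x)].
  rewrite (bigD1 x) //= zB big1 => [|x' /andP[x'X x'x]].
    have [lx px] := X_in _ xX; rewrite inE.
    have [//|zX] := boolP (z \in X); case: (boolP (z \in S)) => //= zS.
    have zx : z = x.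
      move: zB; rewrite !inE => /orP[/eqP zy|eyz].
        by case: px; rewrite -zy zS.
      by case: px => _ _; apply; rewrite // e_sym.
    by rewrite zx xX in zX.
  have [lx px] := X_in _ xX; have [lx' px'] := X_in _ x'X.
  apply/eqP; rewrite eqb0; apply/negP => /(reachB _ _ x'X) r'.
  rewrite eq_sym in x'x.
  by have := reach_disjoint ad lx lx' x'x (reachB _ _ xX zB); rewrite r'.
rewrite big1 => [|x xX]; first by case: ifP.
apply/eqP; rewrite eqb0; apply: contra none => zB.
by apply/existsP; exists x; rewrite xX.
Qed.

End PrivateNeighbours.

Section FewInner.
Variables (S : {set V}) (F : rel V).
Hypothesis ad : optimal S F.

Section DegreeSums.
Import Order.TTheory.

Lemma far_apartI l (A : {set V}) :
  (forall x y n, x \in A -> y \in A -> x != y -> has_walk e n x y -> l <= n) ->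
  far_apart e l A.
Proof.
move=> far; apply/forall_inP=> x xA; apply/forall_inP=> y yA; apply/implyP=> xy.
by apply: le_bigmin => [|n xyn]; rewrite ?leey // lee_fin lez_nat (far x y).
Qed.

Lemma sigma_le l m (A : {set V}) (b : int) : (b%:E <= sigma e l m)%E ->
  #|A| = m -> far_apart e l A -> (b <= (\sum_(a in A) deg e a)%N%:Z)%R.
Proof.
move=> b_le Am far; rewrite -lee_fin; apply: le_trans b_le _.
by apply: (@bigmin_le_cond _ _ _ _ A); rewrite Am eqxx.
Qed.

End DegreeSums.

(** For the second condition only the two private neighbours at distance at least
    five have their degrees bounded from below; the other two have degree at
    least one, which accounts for the difference between 7 and 9. *)
Lemma few_inner_vertices (X : {set V}) (y : V -> V) : #|X| = 4 ->
  (forall x, x \in X -> leaf S F x /\ private S x (y x)) ->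
  (exists x x', [/\ x \in X, x' \in X, x != x' & forall c, ~ link S x x' c]) ->
  ((#|V|%:Z - 7%:Z)%R%:E <= sigma e 4 4)%E \/
  ((#|V|%:Z - 9%:Z)%R%:E <= sigma e 5 2)%E ->
  #|S :\: X| <= 3.
Proof.
have arith4 (j s n : nat) : j + (s + 4) <= n -> n <= s + 7 -> j <= 3 by lia.
have arith5 (j s t n : nat) : j + (s + 4) <= n -> t + 2 <= s -> n <= t + 9 -> j <= 3.
  by lia.
move=> X4 X_in [x [x' [xX x'X xx' no_link]]] sig.
have y_inj : {in X &, injective y}.
  move=> a b aX bX yab; apply/eqP/negPn/negP => ab.
  have [la pa] := X_in _ aX; have [lb pb] := X_in _ bX.
  have := reach_disjoint ad la lb ab (private_reach pa).
  by rewrite yab private_reach.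
have walk a b n : a \in X -> b \in X -> a != b -> has_walk e n (y a) (y b) ->
    3 < n /\ (n < 5 -> exists c, link S a b c).
  move=> aX bX ab; have [la pa] := X_in _ aX; have [lb pb] := X_in _ bX.
  exact: (walk_link ad la lb ab pa pb).
have := closed_nbhds_count ad X_in.
have sumE : \sum_(a in X) (deg e (y a)).+1 = \sum_(a in X) deg e (y a) + 4.
  by rewrite -X4 -sum1_card -big_split; apply: eq_bigr => a _; rewrite /= addn1.
rewrite sumE => count_le.
case: sig => [sig4|sig5].
  have Y4 : #|y @: X| = 4 by rewrite card_in_imset.
  have far : far_apart e 4 (y @: X).
    apply: far_apartI => _ _ n /imsetP[a aX ->] /imsetP[b bX ->] yab /walk.
    by case=> //; apply: contraNneq yab => ->.
  have := sigma_le sig4 Y4 far.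
  rewrite big_imset //= => le4; move: count_le le4.
  by rewrite Num.Theory.lerBlDr -PoszD lez_nat; apply: arith4.
have yxx' : y x != y x' by apply: contra_neq xx'; apply: y_inj.
have A2 : #|[set y x; y x']| = 2 by rewrite cards2 yxx'.
have far : far_apart e 5 [set y x; y x'].
  apply: far_apartI => u v n; rewrite !inE.
  move=> /orP[]/eqP-> /orP[]/eqP->; rewrite ?eqxx // => _ w.
    have [_ lk] := walk _ _ _ xX x'X xx' w; rewrite leqNgt; apply/negP => /lk[c].
    exact: no_link.
  have [|_ lk] := walk x' x n x'X xX _ w; first by rewrite eq_sym.
  rewrite leqNgt; apply/negP => /lk[c [cS c1 c2]].
  by apply: (no_link c).
have := sigma_le sig5 A2 far.
rewrite big_setU1 ?inE // big_set1.
have deg1 a : a \in X -> 0 < deg e (y a).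
  move=> aX; have [la [_ ya _]] := X_in _ aX; rewrite e_sym in ya; exact: deg_gt0 ya.
have sum_le : deg e (y x) + deg e (y x') + 2 <= \sum_(a in X) deg e (y a).
  rewrite (bigD1 x) // (bigD1 x') /=; last by rewrite x'X eq_sym.
  rewrite -addnA leq_add2l leq_add2l.
  have -> : 2 = \sum_(a in X :\ x :\ x') 1.
    by rewrite sum1_card; have := cardsD1 x X; have := cardsD1 x' (X :\ x);
      rewrite !inE xX x'X [x' == x]eq_sym xx' X4 /= => -> [->].
  rewrite [X in _ <= X](eq_bigl (fun a => a \in X :\ x :\ x')); last first.
    by move=> a; rewrite !inE; case: (a \in X); rewrite /= ?andbF ?andbT // andbC.
  by apply: leq_sum => a; rewrite !inE => /and3P[_ _ aX]; apply: deg1.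
by rewrite Num.Theory.lerBlDr -PoszD lez_nat; apply: arith5 count_le sum_le.
Qed.

(** * Four leaves and at most three further vertices *)

Section Cover.
Variable X : seq V.
Hypotheses (uX : uniq X) (sX : size X = 4).
Hypothesis X_leaf : forall x, x \in X -> leaf S F x.
Hypothesis X_priv : forall x, x \in X -> exists y, private S x y.

Let I := S :\: [set x in X].

Let indep : independent e X.
Proof.
move=> x y xX yX; have [->|xy] := eqVneq x y; first by rewrite e_irr.
exact: leaf_nonadj ad (X_leaf xX) (X_leaf yX) xy.
Qed.

Let IE a : (a \in I) = (a \notin X) && (a \in S).
Proof. by rewrite !inE. Qed.

Let I_nbr x : x \in X -> exists2 a, a \in I & e a x.
Proof.
move=> xX; have sg := opt_sg ad; have xS := leaf_in (X_leaf xX).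
have [x' x'X x'x] : exists2 x', x' \in X & x' != x.
  case: X uX sX xX => [|p [|q l]] //=; rewrite inE negb_or.
  case/andP=> /andP[pq _] _ _ _.
  have [px|px] := eqVneq p x.
    by exists q; rewrite ?inE ?eqxx ?orbT // -px eq_sym.
  by exists p; rewrite ?inE ?eqxx.
have [s [Fsx _]] := connect_enter (sg_conn sg (leaf_in (X_leaf x'X)) xS) x'x.
have esx := sg_sub sg Fsx; exists s => //.
rewrite IE (sg_in sg Fsx) andbT; apply/negP => sX'.
by have := indep sX' xX; rewrite esx.
Qed.

(** The private neighbour of x is adjacent to no vertex of S other than x, so two
    non-adjacent neighbours of x in S would form a claw with it. *)
Let I_clique x a b :
  x \in X -> a \in I -> b \in I -> a != b -> e a x -> e b x -> e a b.
Proof.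
move=> xX; rewrite !IE => /andP[_ aS] /andP[_ bS] ab ax bx.
have [y [yS xy priv]] := X_priv xX.
rewrite e_sym in ax; rewrite e_sym in bx.
have ay : a != y by apply: contraNneq yS => <-.
have by_ : b != y by apply: contraNneq yS => <-.
have no t : t \in S -> e x t -> ~~ e t y.
  move=> tS xt; apply/negP => /(priv t tS) tx; move: xt.
  by rewrite tx e_irr.
have [//|eay|eby] := clawP e_sym e_irr claw ax bx xy ab ay by_.
  by have := no a aS ax; rewrite eay.
by have := no b bS bx; rewrite eby.
Qed.

(** A vertex without neighbours in I could be left only through its neighbours in
    X, and these lead back to it; so it would be adjacent to all of X. *)
Let I_not_isolated a : a \in I -> exists2 b, b \in I & e a b.
Proof.
move=> aI; apply: NNPP => none; have sg := opt_sg ad.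
have aS : a \in S by move: aI; rewrite IE => /andP[].
(* Walks from a alternate between a and its neighbours in X. *)
have aX x : x \in S -> x == a \/ x \in X /\ e a x.
  move=> xS; elim/connect_indr: (sg_conn sg aS xS) => [|y z _ + Fyz]; first by left.
  have eyz := sg_sub sg Fyz; have zS := sg_inr sg Fyz.
  have [zX|zX] := boolP (z \in X).
    case=> [/eqP ya|[yX _]]; first by right; rewrite -ya.
    by have := indep yX zX; rewrite eyz.
  have zI : z \in I by rewrite IE zX.
  case=> [/eqP ya|[yX ay]]; first by case: none; exists z; rewrite // -ya.
  have [->|za] := eqVneq z a; [by left | case: none; exists z => //].
  by apply: (I_clique yX) => //; rewrite 1?eq_sym // e_sym.
have aN x : x \in X -> e a x.
  move=> xX; case: (aX x (leaf_in (X_leaf xX))) => [/eqP xa|[]//].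
  by move: aI; rewrite IE -xa xX.
have := @no_three _ _ e_sym e_irr claw X a; move: uX sX indep aN.
case: X => [|p [|q [|r l]]] // u4 _ ind aN T3.
have : uniq ([:: p; q; r] ++ l) := u4; rewrite cat_uniq => /andP[u3 _].
have inX t : t \in [:: p; q; r] -> t \in [:: p, q, r & l].
  by move=> ti; rewrite -[_ :: _]/([:: p; q; r] ++ l) mem_cat ti.
have [pX qX rX] : [/\ p \in [:: p, q, r & l], q \in [:: p, q, r & l] &
    r \in [:: p, q, r & l]].
  by split; apply: inX; rewrite !inE eqxx ?orbT.
by have := T3 p q r ind u3 pX qX rX (aN p pX) (aN q qX); rewrite aN.
Qed.

(** The inner vertices have no isolated vertex among them, and two of them are
    not enough by [not_two_centres]; so there are three of them, one of which is
    adjacent to the other two. *)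
Lemma few_inner_spider : #|I| <= 3 ->
  exists c l1 l2 l3, spider_on e c l1 l2 l3 /\ {subset S <= c :: l1 ++ l2 ++ l3}.
Proof.
move=> I3.
have [x0 x0X] : exists x, x \in X.
  by case: X sX => // x l _; exists x; rewrite inE eqxx.
have [a aI _] := I_nbr x0X; have [b bI ab] := I_not_isolated aI.
have aNb : a != b by apply: contraTneq ab => ->; rewrite e_irr.
have NX t : t \in I -> t \notin X by rewrite IE => /andP[].
have [c [cI ca cb]] : exists c, [/\ c \in I, c != a & c != b].
  apply: NNPP => none.
  apply: (not_two_centres e_sym e_irr claw uX sX indep (NX b bI) ab).
  move=> x xX; have [t tI tx] := I_nbr xX.
  have [<-|ta] := eqVneq t a; first by rewrite tx.
  have [<-|tb] := eqVneq t b; first by rewrite tx orbT.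
  by case: none; exists t.
have I_abc t : t \in I -> t \in [:: a; b; c].
  have sub : [set a; b; c] \subset I.
    apply/subsetP=> z; rewrite inE in_set2 in_set1 -orbA.
    by case/or3P=> /eqP->.
  have c3 : #|[set a; b; c]| = 3.
    by rewrite setUC cardsU1 cards2 !inE negb_or ca cb aNb.
  have -> : I = [set a; b; c] by apply/eqP; rewrite eq_sym eqEcard sub c3.
  by rewrite !inE orbA.
have cover u v w : (forall t, t \in I -> t \in [:: u; v; w]) ->
    [/\ u \in I, v \in I & w \in I] -> uniq [:: u; v; w] -> e u v -> e v w ->
    exists c l1 l2 l3, spider_on e c l1 l2 l3 /\ {subset S <= c :: l1 ++ l2 ++ l3}.
  move=> Iuvw [uI vI wI] u3 uv vw.
  have inI t : t \in [:: u; v; w] -> t \in I.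
    by rewrite !inE -!IE => /or3P[]/eqP->.
  apply: (cover_by_spider e_sym e_irr claw uX sX u3) => //.
  - by move=> x xX; apply/negP => /inI/NX; rewrite xX.
  - move=> x xS; rewrite mem_cat; have [//|xX] := boolP (x \in X).
    by rewrite Iuvw ?orbT // IE xX.
  - move=> x xX; have [t /Iuvw + tx] := I_nbr xX.
    by rewrite !inE => /or3P[]/eqP<-; rewrite tx ?orbT.
  - by move=> x s t xX /inI sI /inI tI; apply: I_clique.
have [d /I_abc dabc cd] := I_not_isolated cI.
have ba : e b a by rewrite e_sym.
move: dabc; rewrite !inE => /or3P[]/eqP dE; rewrite dE in cd.
- apply: (cover b a c) => //; last by rewrite e_sym.
    by move=> t /I_abc; rewrite !inE => /or3P[]->; rewrite ?orbT.
  by rewrite /= !inE negb_or ![_ == c]eq_sym cb ca eq_sym aNb.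
- apply: (cover a b c) => //; last by rewrite e_sym.
  by rewrite /= !inE negb_or ![_ == c]eq_sym cb ca aNb.
by rewrite e_irr in cd.
Qed.

End Cover.
End FewInner.
End LeastExcess.

Theorem theorem1p10 (V : finType) (e : rel V)
    (e_sym : symmetric e) (e_irr : irreflexive e)
    (e_conn : connected_graph e) (e_claw : claw_free e)
    (e_sigma : ((#|V|%:Z - 7%:Z)%R%:E <= sigma e 4 4)%E \/
               ((#|V|%:Z - 9%:Z)%R%:E <= sigma e 5 2)%E) :
  exists t : rel V, spanning_tree e t /\ stem_is_spider t.
Proof.
case: e_conn => V_gt0 conn.
apply: NNPP => no_tree.
have no_spider S F : subgraph e S F -> dominating e S -> 1 < #|branches F|.
  move=> sg dom; rewrite ltnNge; apply/negP => br; apply: no_tree.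
  exact: (spanning_tree_of_spider e_sym e_irr V_gt0 sg dom br).
pose good SF := subgraph e SF.1 SF.2 /\ dominating e SF.1.
have [|[S0 F0] [[sg0 dom0] min0]] := @exists_minimal _ good (fun SF => excess SF.2).
  exists ([set: V], e); split; last by move=> v; left; rewrite inE.
  by split=> //= x y; rewrite ?inE.
pose k := excess F0.
have k_min S F : subgraph e S F -> dominating e S -> k <= excess F.
  by move=> sg dom; apply: (min0 (S, F)).
have k_gt0 : 0 < k.
  have /card_gt1P[b [_ [+ _ _]]] := no_spider _ _ sg0 dom0.
  by rewrite inE /k /excess (bigD1 b) //= addn_gt0 subn_gt0 => ->.
pose opt SF := optimal e k SF.1 SF.2.
have [|[S F] [/= ad min]] := @exists_minimal _ opt (fun SF => darts SF.2).
  by exists (S0, F0); split.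
have sg := opt_sg ad.
have br : bridges F.
  apply: (min_bridges sg) => F' sgF' F'F; apply: (min (S, F')); split=> //.
    exact: opt_dom ad.
  apply: leq_trans (excess_le _) (opt_excess ad) => x.
  by rewrite leq_max (deg_subrel x F'F) orbT.
have /card_gt1P[b [b' [+ + bb']]] := no_spider _ _ sg (opt_dom ad).
rewrite !inE => b3 b'3.
have [x1 [x2 [x3 [x4 [uX X_leaf sep]]]]] := four_leaves e_irr sg br bb' b3 b'3.
set X := [:: x1; x2; x3; x4] in uX X_leaf.
have priv x : x \in X -> exists y, private e S x y.
  move=> xX; apply: (private_neighbour e_irr k_gt0 k_min ad _ (X_leaf x xX)).
  by move=> S' F' ad'; apply: (min (S', F')).
have [y yP] : exists y : V -> V, forall x, x \in X -> private e S x (y x).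
  apply: (@fin_all_exists _ _ (fun x y => x \in X -> private e S x y)) => x.
  by have [/priv[y py]|_] := boolP (x \in X); [exists y | exists x].
have X4 : #|[set x in X]| = 4 by rewrite cardsE (card_uniqP uX).
have [|c [l1 [l2 [l3 [sp sub]]]]] :=
    few_inner_spider e_sym e_irr e_claw k_gt0 k_min ad uX (erefl _) X_leaf priv.
  apply: (few_inner_vertices e_sym e_irr k_gt0 k_min ad X4 _ _ e_sigma) => [x|].
    by rewrite inE => xX; split; [apply: X_leaf | apply: yP].
  apply: NNPP => none.
  apply: (@not_all_linked _ _ e_sym e_irr e_claw k k_gt0 k_min S F ad b x1 x2 x3 x4).
  split=> // x x' xX x'X xx'; apply: NNPP => no_c; apply: none.
  exists x, x'; split=> [|||c lk] //; rewrite ?in_set //.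
  by apply: no_c; exists c.
have [F' [sg' br']] := spider_subgraph e_sym sp.
have dom' : dominating e [set v in c :: l1 ++ l2 ++ l3].
  move=> v; case: (opt_dom ad v) => [vS|[u uS euv]]; first by left; rewrite inE sub.
  by right; exists u; rewrite // inE sub.
by have := no_spider _ _ sg' dom'; rewrite ltnNge br'.
Qed.
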